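(* Let $C$ be an extension base and $I=\langle a_i\rangle$ an infinite sequence indiscernible over $C$. Then $I$ is a witness over $C$ if and only if for every $i$ we have $a_{\neq i}\downarrow_C a_i$.
   Context: $T$ is a complete first-order dependent (NIP) theory; we work in a monster model. $x\downarrow_C B$ means $\operatorname{tp}(x/CB)$ does not fork over $C$; $a_{\neq i}$ denotes $\langle a_j : j\neq i\rangle$. $C$ is an extension base if no type over $C$ forks over $C$. A witness over $C$ is an infinite sequence $I$ of tuples all of the same type over $C$ such that for every formula $\varphi(x,y)$ over $C$ and every $e$ of that type, if $\varphi(x,e)$ divides over $C$ then $\{\varphi(x,e'):e'\in I_0\}$ is inconsistent for every countably infinite $I_0\subseteq I$. *)

(* Defs.v *)
From mathcomp Require Import all_boot all_order.
From mathcomp Require Import all_classical.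

Set Implicit Arguments.
Unset Strict Implicit.
Unset Printing Implicit Defensive.

Local Open Scope classical_set_scope.

(** * First-order languages, structures, satisfaction *)

Record language : Type := Language {
  func : Type;
  rel_sym : Type;
  func_arity : func -> nat;
  rel_arity : rel_sym -> nat }.

(* The variables are the elements of an arbitrary type [V], so tuples of
   variables may be infinite; every term and formula still uses only finitely
   many of them. A binder adds the variable [None]. *)
Inductive term (L : language) (V : Type) : Type :=
| Var : V -> term L V
| App : forall f : func L, ('I_(func_arity f) -> term L V) -> term L V.

Inductive formula (L : language) (V : Type) : Type :=
| FFalse : formula L V
| FEq : term L V -> term L V -> formula L V
| FRel : forall r : rel_sym L, ('I_(rel_arity r) -> term L V) -> formula L V
| FImp : formula L V -> formula L V -> formula L V
| FAll : formula L (option V) -> formula L V.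

Arguments Var {L V}.
Arguments App {L V}.
Arguments FFalse {L V}.
Arguments FRel {L V}.

Definition FNot (L : language) (V : Type) (phi : formula L V) : formula L V :=
  FImp phi FFalse.

Definition sentence (L : language) : Type := formula L void.

Record structure (L : language) : Type := Structure {
  carrier :> Type;
  carrier_inhabited : inhabited carrier;
  func_interp : forall f : func L, ('I_(func_arity f) -> carrier) -> carrier;
  rel_interp : forall r : rel_sym L, ('I_(rel_arity r) -> carrier) -> Prop }.

Fixpoint eval (L : language) (M : structure L) (V : Type) (v : V -> M)
    (t : term L V) : M :=
  match t with
  | Var x => v x
  | App f args => func_interp (fun i => eval v (args i))
  end.

Fixpoint sat (L : language) (M : structure L) (V : Type) (v : V -> M)
    (phi : formula L V) {struct phi} : Prop :=
  match phi with
  | FFalse => False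
  | FEq t u => eval v t = eval v u
  | FRel r args => rel_interp (fun i => eval v (args i))
  | FImp phi1 phi2 => sat v phi1 -> sat v phi2
  | FAll phi1 => forall m : M, sat (oapp v m) phi1
  end.

(** * Theories *)

Definition is_model (L : language) (T : set (sentence L)) (M : structure L)
    : Prop :=
  forall s, T s -> sat (of_void M) s.

Definition entails (L : language) (T : set (sentence L)) (s : sentence L)
    : Prop :=
  forall M : structure L, is_model T M -> sat (of_void M) s.

Definition complete_theory (L : language) (T : set (sentence L)) : Prop :=
  (exists M : structure L, is_model T M) /\
  forall s, entails T s \/ entails T (FNot s).

(* Assignment for a formula phi(x, y) whose variables are split in two. *)
Definition join (X Y U : Type) (x : X -> U) (y : Y -> U) (s : X + Y) : U :=
  match s with inl i => x i | inr j => y j end.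

(* phi(x; y) has the independence property in M. *)
Definition has_IP (L : language) (M : structure L) (n m : nat)
    (phi : formula L ('I_n + 'I_m)) : Prop :=
  exists (a : nat -> 'I_m -> M) (b : set nat -> 'I_n -> M),
    forall (S : set nat) (i : nat), sat (join (b S) (a i)) phi <-> S i.

Definition dependent (L : language) (T : set (sentence L)) : Prop :=
  forall M : structure L, is_model T M ->
  forall (n m : nat) (phi : formula L ('I_n + 'I_m)), ~ has_IP M phi.

(** * Types *)

Section Types.
Variables (L : language) (M : structure L).

(* A formula over [A] in the variables [X] is a [formula L (X + A)]: each
   element of [A] is used as a name for itself. *)
Definition holds (A : set M) (X : Type) (x : X -> M) (phi : formula L (X + A))
    : Prop :=
  sat (join x (fun c : A => val c)) phi.

Definition tp (A : set M) (X : Type) (x : X -> M) : set (formula L (X + A)) :=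
  [set phi | holds x phi].
Arguments tp A {X} x.

Definition realizes (A : set M) (X : Type) (p : set (formula L (X + A)))
    (x : X -> M) : Prop :=
  forall phi, p phi -> holds x phi.

Definition finitely_satisfiable (A : set M) (X : Type)
    (p : set (formula L (X + A))) : Prop :=
  forall q, q `<=` p -> finite_set q -> exists x : X -> M, realizes q x.

Definition complete_type (A : set M) (X : Type) (p : set (formula L (X + A)))
    : Prop :=
  finitely_satisfiable p /\ forall phi, p phi \/ p (FNot phi).

(** * Monster models *)

(* A type [kappa] stands for its cardinality; [small kappa A] is |A| < kappa. *)
Definition small (kappa : Type) (U : Type) (A : set U) : Prop :=
  ~ ([set: kappa] #<= A)%card.

Definition saturated (kappa : Type) : Prop :=
  forall (A : set M) (p : set (formula L (unit + A))),
    small kappa A -> finitely_satisfiable p -> exists x, realizes p x.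

Definition automorphism (sigma : M -> M) : Prop :=
  [/\ bijective sigma,
      forall (f : func L) (args : 'I_(func_arity f) -> M),
        sigma (func_interp args) = func_interp (sigma \o args)
    & forall (r : rel_sym L) (args : 'I_(rel_arity r) -> M),
        rel_interp args <-> rel_interp (sigma \o args)].

Definition elementary_map (A : set M) (f : A -> M) : Prop :=
  forall phi : formula L A, sat (fun c : A => val c) phi <-> sat f phi.

Definition strongly_homogeneous (kappa : Type) : Prop :=
  forall (A : set M) (f : A -> M), small kappa A -> elementary_map f ->
    exists2 sigma, automorphism sigma & forall c : A, sigma (val c) = f c.

(** * Dividing and forking *)

(* The formula phi(x, e), where phi(x, y) is over C, divides over C. *)
Definition divides (C : set M) (X Y : Type) (phi : formula L ((X + Y) + C))
    (e : Y -> M) : Prop :=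
  exists (k : nat) (b : nat -> Y -> M),
    (forall i, tp C (b i) = tp C e) /\
    forall s : 'I_k -> nat, injective s ->
      ~ exists x : X -> M, forall i, holds (join x (b (s i))) phi.

(* Implication is read in M, as usual in a monster model: it is only used for
   types over small sets. *)
Definition forks (C A : set M) (X : Type) (p : set (formula L (X + A)))
    : Prop :=
  exists (n : nat) (m : 'I_n -> nat)
    (psi : forall i, formula L ((X + 'I_(m i)) + C))
    (b : forall i, 'I_(m i) -> M),
    (forall i, divides (psi i) (b i)) /\
    forall x : X -> M, realizes p x -> exists i, holds (join x (b i)) (psi i).

(* x is independent from B over C. *)
Definition indep (C : set M) (X : Type) (x : X -> M) (B : set M) : Prop :=
  ~ forks C (tp (C `|` B) x).

Definition extension_base (C : set M) : Prop :=
  forall (n : nat) (p : set (formula L ('I_n + C))),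
    complete_type p -> ~ forks C p.

(** * Indiscernible sequences and witnesses *)

Section Sequences.
Variables (d : Order.disp_t) (I : orderType d) (Y : Type).

Definition indiscernible (C : set M) (a : I -> Y -> M) : Prop :=
  forall (n : nat) (s t : 'I_n -> I),
    (forall k l : 'I_n, (k < l)%N -> (s k < s l)%O) ->
    (forall k l : 'I_n, (k < l)%N -> (t k < t l)%O) ->
    tp C (fun z : 'I_n * Y => a (s z.1) z.2) =
    tp C (fun z : 'I_n * Y => a (t z.1) z.2).

(* Subsequences are sets of indices, so repeated terms are counted with
   multiplicity. *)
Definition witness (C : set M) (a : I -> Y -> M) : Prop :=
  [/\ infinite_set [set: I],
      forall i j, tp C (a i) = tp C (a j)
    & forall (n : nat) (phi : formula L (('I_n + Y) + C)) (e : Y -> M),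
        (forall i, tp C e = tp C (a i)) -> divides phi e ->
        forall J : set I, (J #= [set: nat])%card ->
          ~ exists x : 'I_n -> M, forall j, J j -> holds (join x (a j)) phi].

(* The tuple of all the terms except the i-th one. *)
Definition others (a : I -> Y -> M) (i : I) (z : {j : I | j != i} * Y) : M :=
  a (val z.1) z.2.

End Sequences.
End Types.

Arguments tp {L M} A {X} x.
Arguments others {L M d I Y} a i z.

(* The monster model: kappa is uncountable and larger than the language, and
   "small" means of cardinality less than kappa. *)
Definition monster (L : language) (T : set (sentence L)) (kappa : Type)
    (M : structure L) : Prop :=
  [/\ is_model T M,
      small kappa [set: nat] /\
        small kappa [set: func L] /\ small kappa [set: rel_sym L],
      saturated M kappa
    & strongly_homogeneous M kappa].

(* Main.v *)
Require Import Defs.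
From mathcomp Require Import all_boot all_order.
From mathcomp Require Import all_classical.

(* In an NIP theory, if [c_t] are terms such that the other terms are
   independent from [c_t] over [C] and [psi(x, c_t)] divides, then the patterns
   of [psi] on the [c_t] can be changed one place at a time, so that
   consistency of all the [psi(x, c_t)] would shatter the set of the [c_t].
   This is the right-to-left implication. For the converse, if the type of
   [a_{<> i}] over [C a_i] forked, some formula of it would divide, since
   forking and dividing coincide over an extension base; by indiscernibility
   its instances along [I] are consistent, so [I] would not be a witness.

   That forking implies dividing is shown as in Chernikov and Kaplan. The broom
   lemma, run over a countable elementary hull independent from the parameters,
   shows that a disjunction of dividing formulas has finitely many conjugates
   whose conjunction is inconsistent. Hence every tuple has an infinite
   sequence of conjugates, each independent from the others, and by the first
   paragraph every dividing formula is boundedly consistent along it. So is a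
   disjunction of dividing formulas, which therefore divides. *)

Set Implicit Arguments.
Unset Strict Implicit.
Unset Printing Implicit Defensive.
Local Open Scope classical_set_scope.
Local Open Scope nat_scope.

(** * Cardinality and a combinatorial lemma *)

(** The tuples here may have any small length and [C] any small size, while saturation is assumed
    for one variable only. So no global types and no Morley sequences occur: everything is cut down
    to finite tuples and finite arrays, compactness ([saturation]) builds the rest for countable
    tuples, and homogeneity ([move_tuple]) carries long tuples along. Within the argument
    independence means non-dividing ([indep_div]), which is left transitive over any small [C].

    The hull in the broom lemma need not contain [C] or be elementary for the whole language. Only
    finitely many predicates matter at a time, and they absorb their parameters from [C], so Skolem
    functions for these predicates suffice and the hull is countable.

    The inconsistent sequences that drive the broom are transversals of an array with [N] rows, each
    row being [K] terms of a dividing sequence: if all transversals were consistent, the formula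
    would shatter one of them. *)

Definition embeds (A B : Type) : Prop := exists f : A -> B, injective f.

Lemma embeds_trans A B C : embeds A B -> embeds B C -> embeds A C.
Proof. by move=> [f fi] [g gi]; exists (g \o f); exact: inj_comp. Qed.

Lemma embeds_add A A' B B' :
  embeds A A' -> embeds B B' -> embeds (A + B) (A' + B').
Proof.
move=> [f fi] [g gi].
exists (fun s => match s with inl x => inl (f x) | inr y => inr (g y) end).
by move=> [x|x] [y|y] //= [] => [/fi ->|/gi ->].
Qed.

Definition in_sub (T : Type) (A : set T) (x : T) (Ax : A x) : A :=
  exist _ x (mem_set Ax).

Lemma card_leP_embeds (T U : Type) (A : set T) (B : set U) :
  (A #<= B)%card <-> embeds A B.
Proof.
split=> [/card_leP[f]|[f fi]]; first by
  exists f => x y e; apply: (@inj _ _ _ f); rewrite ?in_setT.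
by apply/card_leP/injfunPex; exists f => // x y _ _ /fi.
Qed.

Lemma embeds_setT T : embeds [set: T] T.
Proof. by exists val; exact: val_inj. Qed.

Lemma embeds_Tset T : embeds T [set: T].
Proof. by exists (fun x => in_sub (I : setT x)) => x y []. Qed.

Lemma infinite_set_embeds (T : Type) (A : set T) : infinite_set A <-> embeds nat A.
Proof.
split=> [/infiniteP/card_leP_embeds|H].
  exact: embeds_trans (embeds_Tset _).
by apply/infiniteP/card_leP_embeds; exact: embeds_trans (embeds_setT _) H.
Qed.

Lemma infinite_setT_embeds (T : Type) : infinite_set [set: T] <-> embeds nat T.
Proof.
split=> [/infinite_set_embeds|] H; first exact: embeds_trans H (embeds_setT _).
by apply/infinite_set_embeds; exact: embeds_trans H (embeds_Tset _).
Qed.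

(** Zorn on the graphs of partial injections: a maximal one is total on one of the two sides, since
    otherwise a pair of missed points could be added. *)
Lemma embeds_total (A B : Type) : embeds A B \/ embeds B A.
Proof.
pose P := [set G : set (A * B) | forall p q, G p -> G q ->
  (p.1 = q.1 <-> p.2 = q.2)].
have [F FP Ftot|G [PG maxG]] := @Zorn_bigcup (A * B) P.
  move=> p q [X FX Xp] [Y FY Yq].
  by case: (Ftot X Y FX FY) => XY;
    [apply: (FP Y) => //; exact: XY | apply: (FP X) => //; exact: XY].
have [dA|] := pselect (forall x, exists y, G (x, y)).
  left; have [f fG] := choice dA; exists f => x x' e.
  by have [_ /(_ e)] := PG _ _ (fG x) (fG x').
move=> /existsNP[x0 /forallNP x0G].
have [dB|] := pselect (forall y, exists x, G (x, y)).
  right; have [f fG] := choice dB; exists f => y y' e.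
  by have [/(_ e)] := PG _ _ (fG y) (fG y').
move=> /existsNP[y0 /forallNP y0G].
exfalso; apply: (maxG (G `|` [set (x0, y0)])).
  split=> [p Gp|H]; first by left.
  by apply: (x0G y0); apply: H; right.
move=> [x y] [x' y'] [Gp|[-> ->]] [Gq|[-> ->]] //=.
- exact: PG Gp Gq.
- split=> e; [case: (x0G y)|case: (y0G x)]; first by rewrite -e.
  by rewrite -e.
- split=> e; [case: (x0G y')|case: (y0G x')]; first by rewrite e.
  by rewrite e.
Qed.

(** Let [D] be the domain of a maximal approximation. If the complement of [D] embeds in [D], then
    [D] absorbs all of [A]. Otherwise the complement is infinite, and a countable part of it extends
    the approximation. *)
Lemma infinite_embeds_double (A : Type) : embeds nat A -> embeds (A + A) A.
Proof.
move=> [i0 i0inj].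
(* Approximations: graphs of injections [D * bool -> D] with [D] included
   in [A]. *)
pose P := [set G : set ((A * bool) * A) |
  [/\ forall p q, G p -> G q -> (p.1 = q.1 <-> p.2 = q.2),
      forall x b y b', G ((x, b), y) -> exists y', G ((x, b'), y') &
      forall x b y, G ((x, b), y) -> exists b' y', G ((y, b'), y')]].
have [F FP Ftot|G [[Ginj Gdom Gcod] maxG]] := @Zorn_bigcup _ P.
  split.
  - move=> p q [X FX Xp] [Y FY Yq].
    by case: (Ftot X Y FX FY) => XY;
      [have [+ _ _] := FP Y FY; apply => //; exact: XY
      |have [+ _ _] := FP X FX; apply => //; exact: XY].
  - move=> x b y b' [X FX Xp]; have [_ + _] := FP X FX.
    by move=> /(_ _ _ _ b' Xp)[y' ?]; exists y', X.
  - move=> x b y [X FX Xp]; have [_ _] := FP X FX.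
    by move=> /(_ _ _ _ Xp)[b' [y' ?]]; exists b', y', X.
pose D := [set x | exists y, G ((x, true), y)].
have DG x b y : G ((x, b), y) -> D x by move=> /(Gdom _ _ _ true)[y' ?]; exists y'.
have [g gG] : exists g : A * bool -> A, forall x b, D x -> G ((x, b), g (x, b)).
  have /choice[g gG] : forall p : A * bool, exists y, D p.1 -> G (p, y).
    move=> [x b] /=; have [Dx|nDx] := pselect (D x); last by exists x.
    by have [y /(Gdom _ _ _ b)[y' Gy']] := Dx; exists y'.
  by exists g => x b Dx; apply: gG.
have gD x b : D x -> D (g (x, b)).
  by move=> Dx; have [b' [y' /DG]] := Gcod _ _ _ (gG x b Dx).
have ginj x b x' b' : D x -> D x' -> g (x, b) = g (x', b') -> (x, b) = (x', b').
  move=> Dx Dx' e; have [_ h] := Ginj _ _ (gG x b Dx) (gG x' b' Dx').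
  exact: h.
have subD (S : set A) : embeds S A by exists val; exact: val_inj.
have DD : embeds (D + D) D.
  exists (fun s => match s with
    | inl x => in_sub (gD (val x) true (set_mem (valP x)))
    | inr x => in_sub (gD (val x) false (set_mem (valP x))) end).
  have Dv (x : D) : D (val x) by exact: set_mem (valP x).
  by move=> [x|x] [y|y] /(congr1 val) /= /(ginj _ _ _ _ (Dv x) (Dv y)) [] // /val_inj ->.
have splitD : embeds A (D + (~` D)).
  exists (fun x => match pselect (D x) with
    | left Dx => inl (in_sub Dx)
    | right nDx => inr (@in_sub _ (~` D) x nDx) end).
  by move=> x y; case: pselect => ? ; case: pselect => ? // [].
have [h|h] := embeds_total (~` D) D.
  have AD : embeds A D.
    apply: embeds_trans splitD _; apply: embeds_trans DD.
    by apply: embeds_add => //; exists id.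
  apply: embeds_trans (subD D); apply: embeds_trans DD.
  exact: embeds_add.
have [j jinj] : embeds nat (~` D).
  apply: (proj1 (infinite_set_embeds _)) => fin_nD.
  have : infinite_set [set: A] by apply/infinite_setT_embeds; exists i0.
  apply; rewrite -(setUv D) finite_setU; split=> //.
  by apply: card_le_finite fin_nD; apply/card_leP_embeds.
have jD n : ~ D (val (j n)) by exact: set_mem (valP (j n)).
(* On the copy of [nat] the doubling is [(n, b) |-> 2n + b]; parity recovers [b]. *)
exfalso; apply: (maxG (G `|` [set q | exists n (b : bool),
    q = ((val (j n), b), val (j (b + n.*2)))])).
  split=> [p Gp|H]; first by left.
  apply: (jD 0); apply: (DG _ true (val (j 1))).
  by apply: H; right; exists 0, true.
split.
- move=> p q [Gp|[n [b ->]]] [Gq|[n' [b' ->]]] /=.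
  + exact: Ginj.
  + split=> e.
      by case: p Gp e => [[x c] y] /= /DG Dx [e _]; case: (jD n'); move: Dx; rewrite e.
    case: p Gp e => [[x c] y] /= Gp e; have [c' [y' /DG]] := Gcod _ _ _ Gp.
    by rewrite e => /jD.
  + split=> e.
      by case: q Gq e => [[x c] y] /= /DG Dx [e _]; case: (jD n); move: Dx; rewrite -e.
    case: q Gq e => [[x c] y] /= Gq e; have [c' [y' /DG]] := Gcod _ _ _ Gq.
    by rewrite -e => /jD.
  + split=> [[/val_inj/jinj -> ->] //|/val_inj/jinj e].
    have eb : b = b' by move/(congr1 odd): e; rewrite !oddD !odd_double !addbF !oddb.
    by move: e; rewrite eb => /addnI/double_inj ->.
- move=> x b y b' [Gp|[n [c [-> _ _]]]].
    by have [y' ?] := Gdom _ _ _ b' Gp; exists y'; left.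
  by exists (val (j (b' + n.*2))); right; exists n, b'.
- move=> x b y [Gp|[n [c [_ _ ->]]]].
    by have [b' [y' ?]] := Gcod _ _ _ Gp; exists b', y'; left.
  by exists true; eexists; right; exists (c + n.*2), true.
Qed.

(** The larger summand absorbs the other one by doubling. This is what makes a union of two small
    sets small ([smallU]), so that parameters can be added to [C]. *)
Lemma embeds_sum (K A B : Type) :
  embeds nat K -> embeds K (A + B) -> embeds K A \/ embeds K B.
Proof.
wlog AB : A B / embeds A B.
  move=> wl nK KAB; have [AB|BA] := embeds_total A B; first exact: wl.
  apply/or_comm; apply: wl => //; apply: embeds_trans KAB _.
  exists (fun s => match s with inl x => inr x | inr y => inl y end).
  by move=> [x|x] [y|y] //= [] ->.
move=> nK KAB; right.
have KBB : embeds K (B + B).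
  by apply: embeds_trans KAB _; apply: embeds_add => //; exists id.
suff BBB : embeds (B + B) B by exact: embeds_trans KBB BBB.
apply: infinite_embeds_double.
apply: (proj1 (infinite_setT_embeds _)) => finB.
have : infinite_set [set: (B + B)%type].
  by apply/infinite_setT_embeds; exact: embeds_trans KBB.
apply; suff -> : [set: (B + B)%type] = (inl @` [set: B]) `|` (inr @` [set: B]).
  by rewrite finite_setU; split; exact: finite_image.
by apply/seteqP; split=> [[x|x] _|//]; [left|right]; exists x.
Qed.

Lemma smallU (kappa U : Type) (A B : set U) :
  small kappa [set: nat] -> small kappa A -> small kappa B ->
  small kappa (A `|` B).
Proof.
move=> knat kA kB /card_leP_embeds kAB.
have kK : embeds nat kappa.
  have [//|kn] := embeds_total nat kappa; case: knat.
  apply/card_leP_embeds; apply: embeds_trans (embeds_Tset _).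
  exact: embeds_trans (embeds_setT _) kn.
have kAB' : embeds kappa (A + B).
  apply: embeds_trans (embeds_Tset _) _; apply: embeds_trans kAB _.
  exists (fun x : A `|` B => match pselect (A (val x)) with
    | left Ax => inl (in_sub Ax)
    | right nAx => inr (in_sub
        (match set_mem (valP x) with or_introl a => False_ind _ (nAx a)
         | or_intror b => b end)) end).
  by move=> x y; case: pselect => ? ; case: pselect => ? // [] /val_inj.
have [kA'|kB'] := embeds_sum kK kAB'.
- by apply: kA; apply/card_leP_embeds; apply: embeds_trans (embeds_setT _) kA'.
- by apply: kB; apply/card_leP_embeds; apply: embeds_trans (embeds_setT _) kB'.
Qed.

Lemma small_countable (kappa U : Type) (A : set U) :
  small kappa [set: nat] -> countable A -> small kappa A.
Proof. by move=> knat cA kA; apply: knat; exact: card_le_trans kA cA. Qed.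

Lemma small_range (kappa : Type) (X : countType) (U : Type) (f : X -> U) :
  small kappa [set: nat] -> small kappa (range f).
Proof.
move=> kappa_nat; apply: small_countable => //.
exact: sub_countable (card_image_le _ _) (countableP _).
Qed.

(* Induction on the rows, for a family of requirements [F]: if the last row is
   long compared with the number of transversals of the other rows, one of its
   columns [a] is missed by a witness for each requirement and each of these
   transversals. Requiring membership or non-membership in column [a] then
   doubles the family. *)
Lemma shattered_transversal (N k r : nat) : exists K, forall (T : finType),
  #|T| = r -> forall (U : Type) (F : T -> U -> Prop) (P : nat -> nat -> U -> Prop),
  (forall i u (s : 'I_k -> nat), i < N -> injective s ->
     exists j, ~ P i (s j) u) ->
  (forall t (eta : nat -> nat), (forall i, eta i < K) ->
     exists u, F t u /\ forall i, i < N -> P i (eta i) u) ->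
  exists2 a : nat -> nat, (forall i, a i < K) &
    forall t (S : nat -> Prop), exists u, F t u /\
      forall i, i < N -> (P i (a i) u <-> S i).
Proof.
elim: N r => [|N IH] r.
  exists 1 => T _ U F P _ H; exists (fun=> 0) => // t S.
  by have [u [Fu _]] := H t (fun=> 0) (fun=> isT); exists u.
have [K1 HK1] := IH (r * 2).
(* Each of the [r * K1 ^ N] pairs of a requirement and a transversal of the other rows excludes at
   most [k] columns of the last row, and one column must remain. The summand [K1] leaves room for
   the shorter rows given by induction. *)
exists (K1 + (r * K1 ^ N) * k).+1 => T Tr U F P Pk H.
pose extend (eta : {ffun 'I_N -> 'I_K1}) a : nat -> nat :=
  fun i => if insub i is Some j then nat_of_ord (eta j) else if i == N then a else 0.
have extend_lt eta a i (iN : i < N) : extend eta a i = eta (Ordinal iN).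
  by rewrite /extend insubT.
have extendN eta a : extend eta a N = a by rewrite /extend insubF ?ltnn ?eqxx.
have extend0_lt (eta : {ffun 'I_N -> 'I_K1}) i :
    extend eta 0 i < (K1 + (r * K1 ^ N) * k).+1.
   rewrite /extend; case: insubP => [j _ _|_].
    by apply: (leq_trans (ltn_ord _)); rewrite leqW // leq_addr.
  by case: ifP.
(* The transversal is continued through column 0 of the last row, an arbitrary choice: only the
   other rows matter for [u]. *)
have /choice[u uP] : forall p : T * {ffun 'I_N -> 'I_K1}, exists u, F p.1 u /\
    forall i, i < N.+1 -> P i (extend p.2 0 i) u.
  by move=> [t eta]; exact: H t (extend eta 0) (extend0_lt eta).
pose bad p := [set a : 'I_(K1 + (r * K1 ^ N) * k).+1 | `[< P N a (u p) >]]%SET.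
have badk p : #|bad p| <= k.
  rewrite leqNgt; apply/negP => kbad.
  have kb : k <= #|bad p| by exact: ltnW.
  pose s (j : 'I_k) : nat := enum_val (widen_ord kb j).
  have sinj : injective s.
    move=> j j'; rewrite /s => /ord_inj /enum_val_inj /(congr1 val) /= e.
    exact: ord_inj.
  have [j] := Pk N (u p) s (ltnSn N) sinj; apply.
  by have := enum_valP (widen_ord kb j); rewrite inE => /asboolP.
have [a aP] : exists a : 'I_(K1 + (r * K1 ^ N) * k).+1, forall p, a \notin bad p.
  apply: contrapT => /forallNP na.
  have : ([set: 'I_(K1 + (r * K1 ^ N) * k).+1] \subset \bigcup_p bad p)%SET.
    apply/fintype.subsetP => a _; have /existsNP[p /negP] := na a.
    by rewrite negbK => abad; apply/bigcupP; exists p.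
  move=> /subset_leq_card; rewrite cardsT card_ord leqNgt => /negP; apply.
  have bigcup_card : (#|\bigcup_p bad p|%SET <= \sum_p #|bad p|)%N.
    elim/big_ind2: _ => [|A m B n Am Bn|//]; first by rewrite cards0.
    by apply: leq_trans (leq_add Am Bn); rewrite leq_card_setU.
  rewrite ltnS (leq_trans bigcup_card)//.
  apply: (@leq_trans (\sum_(p : T * {ffun 'I_N -> 'I_K1}) k)); first exact: leq_sum.
  by rewrite sum_nat_const card_prod card_ffun !card_ord Tr leq_addl.
have [|||b bK bP] := HK1 (T * bool)%type _ U (fun t u => F t.1 u /\ (P N a u <-> t.2)) P.
- by rewrite card_prod card_bool Tr.
- by move=> i v s iN; apply: Pk; exact: ltnW.
(* Membership in column [a] comes from [H] along a transversal through [a]; non-membership from the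
   chosen [u (t, e)], for which [a] is not bad. *)
- move=> [t [|]] eta etaK /=.
    have [|v [Fv vP]] := H t (fun i => if i < N then eta i else a).
      by move=> i; case: ifP => _ //; rewrite (leq_trans (etaK i))// leqW// leq_addr.
    exists v; split; first split=> //.
      by split=> // _; have := vP N (ltnSn N); rewrite ltnn.
    by move=> i iN; have := vP i (leqW iN); rewrite iN.
  pose e := [ffun i : 'I_N => Ordinal (etaK i)].
  have [Fv vP] := uP (t, e).
  exists (u (t, e)); split; first split=> //.
    split=> //= Pa; have := aP (t, e).
    by rewrite inE => /negP[]; apply/asboolP.
  move=> i iN; have := vP i (leqW iN).
  by rewrite /= (extend_lt _ _ _ iN) ffunE.
exists (fun i => if i < N then b i else a).
  by move=> i; case: ifP => _ //; rewrite (leq_trans (bK i))// leqW// leq_addr.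
move=> t S; have [v [[Fv vN] vP]] := bP (t, `[< S N >]) S.
exists v; split=> // i; rewrite ltnS leq_eqVlt => /orP[/eqP ->|iN].
  by rewrite ltnn vN asboolE.
by rewrite iN; exact: vP.
Qed.

(** * Definable predicates *)

Lemma finite_set_enum (X : Type) (S : set X) : finite_set S ->
  exists n (f : 'I_n -> X), injective f /\ forall k, S k <-> exists i, f i = k.
Proof.
elim/Peq : X => X in S * => /finite_seqP[s0 ->].
pose s := undup s0; exists (size s), (tnth (in_tuple s)); split.
  by apply/tuple_uniqP; exact: undup_uniq.
move=> k; split=> /=.
  by rewrite -mem_undup => /(@tnthP _ _ (in_tuple s))[i ->]; exists i.
by move=> [i <-]; rewrite -mem_undup; exact: (mem_tnth i (in_tuple s)).
Qed.

Lemma finite_set_directed (X J : Type) (q : set X) (R : X -> J -> Prop) :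
  finite_set q -> inhabited J ->
  (forall i j, exists k, forall x, R x i \/ R x j -> R x k) ->
  (forall x, q x -> exists j, R x j) -> exists j, forall x, q x -> R x j.
Proof.
elim/Peq : X => X in q R * => /finite_seqP[s ->] [j0] dir.
elim: s => [|x s IH] H; first by exists j0.
have [i iP] : exists i, forall x, [set` s] x -> R x i.
  by apply: IH => y ys; apply: H; rewrite /= inE ys orbT.
have [|j jP] := H x; first by rewrite /= inE eqxx.
have [k kP] := dir i j; exists k => y /=; rewrite inE => /orP[/eqP ->|ys].
  by apply: kP; right.
by apply: kP; left; exact: iP.
Qed.

Section Renaming.
Variable L : language.

Fixpoint term_rename (V W : Type) (f : V -> W) (t : term L V) : term L W :=
  match t with
  | Var x => Var (f x)
  | App g args => App g (fun i => term_rename f (args i))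
  end.

Fixpoint rename (V : Type) (phi : formula L V) : forall W, (V -> W) -> formula L W :=
  match phi with
  | FFalse => fun W f => FFalse
  | FEq t u => fun W f => FEq (term_rename f t) (term_rename f u)
  | FRel r args => fun W f => FRel r (fun i => term_rename f (args i))
  | FImp p q => fun W f => FImp (rename p f) (rename q f)
  | FAll p => fun W f => FAll (rename p (omap f))
  end.

Variable M : structure L.

Lemma eval_rename (V W : Type) (f : V -> W) (w : W -> M) t :
  eval w (term_rename f t) = eval (w \o f) t.
Proof. by elim: t => //= g args IH; congr func_interp; exact/funext. Qed.

Lemma sat_rename (V W : Type) (f : V -> W) (w : W -> M) phi :
  sat w (rename phi f) <-> sat (w \o f) phi.
Proof.
elim: phi W f w => {V} [V|V t u|V r args|V p IHp q IHq|V p IHp] W f w //=.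
- by rewrite !eval_rename.
- by under eq_fun do rewrite eval_rename.
- by rewrite IHp IHq.
- have e m : oapp w m \o omap f = oapp (w \o f) m by apply/funext => -[].
  by split=> H m; move: (H m); rewrite IHp e.
Qed.

Lemma extend_along (Z X : Type) (f : Z -> X) (x : Z -> M) :
  injective f -> exists v : X -> M, v \o f = x.
Proof.
move=> finj; have [m0] := carrier_inhabited M.
have /choice[v vP] : forall k, exists m, forall i, f i = k -> m = x i.
  move=> k; have [[i <-]|nk] := pselect (exists i, f i = k).
    by exists (x i) => j /finj ->.
  by exists m0 => i fi; case: nk; exists i.
by exists v; apply/funext => i /=; exact: vP.
Qed.

Definition depends (V T : Type) (S : set V) (P : (V -> M) -> T) : Prop :=
  forall v w, (forall k, S k -> v k = w k) -> P v = P w.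

Lemma dependsS (V T : Type) (S S' : set V) (P : (V -> M) -> T) :
  S `<=` S' -> depends S P -> depends S' P.
Proof. by move=> SS' dP v w vw; apply: dP => k /SS'; exact: vw. Qed.

Lemma eval_support (V : Type) (t : term L V) :
  exists2 S, finite_set S & depends S (fun v : V -> M => eval v t).
Proof.
elim: t => [x|g args IH].
  by exists [set x]; [exact: finite_set1|move=> v w /(_ x erefl)].
have /choice[S SP] : forall i, exists S, finite_set S /\
    depends S (fun v : V -> M => eval v (args i)).
  by move=> i; have [S ? ?] := IH i; exists S.
exists (\bigcup_i S i); first by apply: bigcup_finite => // i _; case: (SP i).
move=> v w vw /=; congr func_interp; apply/funext => i.
by have [_ dS] := SP i; apply: dS => k Sk; apply: vw; exists i.
Qed.

Lemma sat_support (V : Type) (phi : formula L V) :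
  exists2 S, finite_set S & depends S (fun v : V -> M => sat v phi).
Proof.
elim: phi => {V} [V|V t u|V r args|V p [S fS dS] q [S' fS' dS']|V p [S fS dS]].
- by exists set0.
- have [S fS dS] := eval_support t; have [S' fS' dS'] := eval_support u.
  exists (S `|` S'); first by rewrite finite_setU.
  move=> v w vw /=; rewrite (dS v w) 1?(dS' v w)// => k Sk; apply: vw;
  by [left|right].
- have /choice[S SP] : forall i, exists S, finite_set S /\
      depends S (fun v : V -> M => eval v (args i)).
    by move=> i; have [S ? ?] := eval_support (args i); exists S.
  exists (\bigcup_i S i); first by apply: bigcup_finite => // i _; case: (SP i).
  move=> v w vw /=; congr rel_interp; apply/funext => i.
  by have [_ dS] := SP i; apply: dS => k Sk; apply: vw; exists i.
- exists (S `|` S'); first by rewrite finite_setU.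
  move=> v w vw /=; rewrite (dS v w) 1?(dS' v w)// => k Sk; apply: vw;
  by [left|right].
- exists (\bigcup_(o in S) (if o is Some k then [set k] else set0)).
    by apply: bigcup_finite => // -[k|] _; [exact: finite_set1|].
  move=> v w vw /=; apply: eq_forall => m; apply: dS => -[k|] Sk //=.
  by apply: vw; exists (Some k).
Qed.

End Renaming.

Section DefinableClasses.
Variables (L : language) (M : structure L).

(** The closure conditions common to definability over a set of parameters and definability by codes
    over the hull. Classes of predicates replace formulas, so that conditions are written directly
    in the logic. A quantifier over one variable is enough, since finite blocks follow by
    induction. *)
Record definable_class (D : forall X : Type, ((X -> M) -> Prop) -> Prop) : Prop := {
  class_false : forall X, D X (fun _ => False);
  class_imp : forall X P Q, D X P -> D X Q -> D X (fun x => P x -> Q x);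
  class_all1 : forall X P, D (option X) P -> D X (fun x => forall m, P (oapp x m));
  class_rename : forall X Y P (f : X -> Y), D X P -> D Y (fun y => P (y \o f)) }.

Variable D : forall X : Type, ((X -> M) -> Prop) -> Prop.
Arguments D {X}.
Hypothesis Dclass : definable_class (@D).

Lemma class_iff X P Q : (forall x, P x <-> Q x) -> @D X P -> D Q.
Proof. by move=> PQ; rewrite (_ : P = Q)//; apply/funext => x; exact/propext. Qed.

Lemma class_not X P : @D X P -> D (fun x => ~ P x).
Proof. by move=> DP; apply: class_imp => //; exact: class_false. Qed.

Lemma class_true X : @D X (fun _ => True).
Proof. by apply: class_iff (class_not (class_false Dclass X)) => x; split=> // _ []. Qed.

Lemma class_and X P Q : @D X P -> D Q -> D (fun x => P x /\ Q x).
Proof.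
move=> DP DQ; have := class_not (class_imp Dclass DP (class_not DQ)).
apply: class_iff => x; split=> [H|[p q] h]; last exact: h.
by split; apply: contrapT => h; apply: H.
Qed.

Lemma class_or X P Q : @D X P -> D Q -> D (fun x => P x \/ Q x).
Proof.
move=> DP DQ; apply: class_iff (class_imp Dclass (class_not DP) DQ) => x.
by split=> [H|[]//]; apply: contrapT => /not_orP[p q]; apply: q; exact: H.
Qed.

Lemma class_eqv X P Q : @D X P -> D Q -> D (fun x => P x <-> Q x).
Proof. by move=> DP DQ; apply: class_and; exact: class_imp. Qed.

Lemma class_const X (b : Prop) : @D X (fun _ => b).
Proof.
have [h|h] := pselect b; first by apply: class_iff (class_true X).
by apply: class_iff (class_false Dclass X).
Qed.

Lemma class_bigand_seq X (T : eqType) (s : seq T) (P : T -> (X -> M) -> Prop) :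
  (forall t, t \in s -> D (P t)) -> D (fun x => forall t, t \in s -> P t x).
Proof.
elim: s => [|t s IH] DP; first exact: class_iff (class_true X).
have DPt : D (P t) by apply: DP; rewrite inE eqxx.
have DPs : D (fun x => forall t, t \in s -> P t x).
  by apply: IH => u us; apply: DP; rewrite inE us orbT.
apply: class_iff (class_and DPt DPs) => x; split=> [[pt ps] u|H].
  by rewrite inE => /orP[/eqP ->|/ps].
split=> [|u us]; apply: H; first by rewrite inE eqxx.
by rewrite inE us orbT.
Qed.

Lemma class_bigand X (T : finType) (P : T -> (X -> M) -> Prop) :
  (forall t, D (P t)) -> D (fun x => forall t, P t x).
Proof.
move=> DP; have := class_bigand_seq (s := enum T) (fun t _ => DP t).
by apply: class_iff => x; split=> H t; [apply: H; rewrite mem_enum|].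
Qed.

Lemma class_bigor X (T : finType) (P : T -> (X -> M) -> Prop) :
  (forall t, D (P t)) -> D (fun x => exists t, P t x).
Proof.
move=> DP; have := class_not (class_bigand (fun t => class_not (DP t))).
apply: class_iff => x; split=> [H|[t pt] /(_ t)//].
by apply: contrapT => /forallNP.
Qed.

Lemma class_all X (Z : finType) (P : (X + Z -> M) -> Prop) :
  D P -> D (fun x => forall z : Z -> M, P (join x z)).
Proof.
have ord_case : forall n X (P : (X + 'I_n -> M) -> Prop),
    D P -> D (fun x => forall z : 'I_n -> M, P (join x z)).
  elim=> [|n IH] {}X {}P DP.
    have h : 'I_0 -> X by move=> [].
    apply: class_iff (class_rename Dclass (join id h) DP) => x.
    split=> [H z|/(_ (x \o h))]; [move: H|]; congr P;
    by apply/funext => -[k|[]].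
  pose g (k : X + 'I_n.+1) : option X + 'I_n := match k with
    | inl k => inl (Some k)
    | inr i => if unlift ord0 i is Some j then inr j else inl None end.
  have := class_all1 Dclass (IH _ _ (class_rename Dclass g DP)).
  apply: class_iff => x; split=> [H z|H m z].
    have := H (z ord0) (z \o lift ord0); congr P; apply/funext => -[k|i] //=.
    by case: unliftP => [j|] ->.
  have := H (fun i => if unlift ord0 i is Some j then z j else m).
  by congr P; apply/funext => -[k|i] //=; case: unliftP.
move=> DP; pose g (k : X + Z) : X + 'I_#|Z| :=
  match k with inl k => inl k | inr z => inr (enum_rank z) end.
have := ord_case _ _ _ (class_rename Dclass g DP); apply: class_iff => x.
split=> [/[swap] z /(_ (z \o enum_val))|/[swap] z /(_ (z \o enum_rank))];
  congr P; apply/funext => -[k|k] //=.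
by rewrite enum_rankK.
Qed.

Lemma class_ex X (Z : finType) (P : (X + Z -> M) -> Prop) :
  D P -> D (fun x => exists z : Z -> M, P (join x z)).
Proof.
move=> DP; have := class_not (class_all (class_not DP)).
apply: class_iff => x; split=> [H|[z pz] /(_ z)//].
by apply: contrapT => /forallNP.
Qed.

Lemma class_factor X Z (S : set X) (f : Z -> X) (P : (X -> M) -> Prop) :
  depends S P -> (forall k, S k -> exists i, f i = k) -> D P ->
  exists2 Q : (Z -> M) -> Prop, D Q & forall x, P x = Q (x \o f).
Proof.
move=> dP fS DP.
have /choice[g gP] : forall k, exists o : option Z,
    if o is Some i then f i = k else ~ S k.
  move=> k; have [[i fi]|nk] := pselect (exists i, f i = k).
    by exists (Some i).
  by exists None => /fS.
(* The variables outside the range of [f] do not matter, but still need a value. It is quantified,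
   since a fixed element of [M] might not be an allowed parameter. *)
exists (fun z => forall m, P (oapp z m \o g)).
  exact: class_all1 (class_rename Dclass g DP).
move=> x; apply/propext; split=> [Px m|H].
  rewrite (dP _ x)// => k Sk /=; have := gP k.
  by case: (g k) => // i /= ->.
have [m0] := carrier_inhabited M; have := H m0.
rewrite (dP _ x)// => k Sk /=; have := gP k.
by case: (g k) => // i /= ->.
Qed.

Hypothesis Dsupport : forall X P, @D X P ->
  exists2 S, finite_set S & depends S P.

(** A quantifier over an infinite tuple is harmless: the predicate reads only finitely many entries,
    and the others can be filled in afterwards. *)
Lemma class_exT X Z (P : (X + Z -> M) -> Prop) :
  D P -> D (fun x => exists z : Z -> M, P (join x z)).
Proof.
move=> DP; have [S fS dS] := Dsupport DP.
have [n [f [finj fP]]] : exists n (f : 'I_n -> Z), injective f /\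
    forall k, S (inr k) -> exists i, f i = k.
  pose S' := \bigcup_(o in S) (if o is inr k then [set k] else set0 : set Z).
  have fS' : finite_set S'.
    by apply: bigcup_finite => // -[k|k] _; [|exact: finite_set1].
  have [n [f [finj fP]]] := finite_set_enum fS'; exists n, f; split=> // k Sk.
  by apply/fP; exists (inr k).
pose g (k : X + 'I_n) : X + Z := match k with inl k => inl k | inr i => inr (f i) end.
have [|Q DQ QP] := class_factor (f := g) dS _ DP.
  by move=> [k|k] Sk; [exists (inl k)|have [i <-] := fP _ Sk; exists (inr i)].
have gE x z : join x z \o g = join x (z \o f) by apply/funext => -[].
have := class_ex DQ; apply: class_iff => x; split=> [[w Qw]|[z]].
  by have [z zf] := extend_along w finj; exists z; rewrite QP gE zf.
by rewrite QP gE => Qz; exists (z \o f).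
Qed.

End DefinableClasses.

Section DefinableOver.
Variables (L : language) (M : structure L).

Definition definable_over (A : set M) (X : Type) (P : (X -> M) -> Prop) : Prop :=
  exists phi : formula L (X + A), forall x, holds x phi <-> P x.

Lemma definable_over_class A : definable_class (@definable_over A).
Proof.
split.
- by move=> X; exists FFalse.
- move=> X P Q [phi phiP] [psi psiP]; exists (FImp phi psi) => x.
  by rewrite -phiP -psiP.
- move=> X P [phi phiP].
  exists (FAll (rename phi (fun k => match k with
    | inl None => None | inl (Some k) => Some (inl k) | inr a => Some (inr a) end))).
  move=> x; rewrite /holds /=; split=> H m; move: (H m).
    rewrite sat_rename -phiP; congr sat; apply/funext; by move=> [[k|]|a].
  rewrite sat_rename -phiP; congr sat; apply/funext; by move=> [[k|]|a].
- move=> X Y P f [phi phiP].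
  exists (rename phi (fun k => match k with inl k => inl (f k) | inr a => inr a end)).
  move=> y; rewrite /holds sat_rename -phiP; split; congr sat; apply/funext;
  by move=> [k|a].
Qed.

Lemma definable_over_inst A B X Y (P : (X + Y -> M) -> Prop) (y : Y -> M) :
  A `<=` B -> (forall k, B (y k)) -> definable_over A P ->
  definable_over B (fun x => P (join x y)).
Proof.
move=> AB yB [phi phiP].
exists (rename phi (fun k => match k with
  | inl (inl k) => inl k
  | inl (inr k) => inr (in_sub (yB k))
  | inr a => inr (in_sub (AB _ (set_mem (valP a)))) end)) => x.
rewrite /holds sat_rename -phiP; split; congr sat; apply/funext;
by move=> [[k|k]|a].
Qed.

Lemma definable_overS A B X (P : (X -> M) -> Prop) :
  A `<=` B -> definable_over A P -> definable_over B P.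
Proof.
move=> AB dP; pose h : void -> M := of_void M.
have dP' := class_rename (definable_over_class A) (@inl X void) dP.
by have := definable_over_inst (y := h) AB (fun k : void => match k with end) dP'.
Qed.

Lemma definable_over_support A X (P : (X -> M) -> Prop) : definable_over A P ->
  exists2 S, finite_set S & depends S P.
Proof.
move=> [phi phiP]; have [S fS dS] := sat_support M phi.
exists (\bigcup_(o in S) (if o is inl k then [set k] else set0)).
  by apply: bigcup_finite => // -[k|a] _; [exact: finite_set1|].
move=> v w vw; apply/propext; rewrite -!phiP /holds.
rewrite (dS _ (join w (fun c : A => val c)))// => -[k|a] Sk //=.
by apply: vw; exists (inl k).
Qed.

(** One direction is enough, because definable predicates are closed under negation. *)
Definition equiv_over (C : set M) (X : Type) (x y : X -> M) : Prop :=
  forall P : (X -> M) -> Prop, definable_over C P -> P x -> P y.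

Lemma equiv_overP C X (x y : X -> M) : equiv_over C x y <-> tp C x = tp C y.
Proof.
split=> [e|e P [phi phiP]].
  apply/seteqP; split=> phi /=.
    by apply: (e (fun x => holds x phi)); exists phi.
  move=> yphi; apply: contrapT => xphi.
  apply: (e (fun x => ~ holds x phi)) xphi yphi.
  by apply: (class_not (definable_over_class C)); exists phi.
rewrite -!phiP => xphi; have : tp C x phi by [].
by rewrite e.
Qed.

Lemma equiv_over_sym C X (x y : X -> M) : equiv_over C x y -> equiv_over C y x.
Proof. by move=> /equiv_overP xy; apply/equiv_overP. Qed.

Lemma equiv_over_trans C X (x y z : X -> M) :
  equiv_over C x y -> equiv_over C y z -> equiv_over C x z.
Proof. by move=> xy yz P dP /(xy P dP)/(yz P dP). Qed.

Lemma equiv_over_rename C X Y (x y : X -> M) (f : Y -> X) :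
  equiv_over C x y -> equiv_over C (x \o f) (y \o f).
Proof.
move=> xy P dP; apply: (xy (fun x => P (x \o f))).
exact: (class_rename (definable_over_class C)).
Qed.

End DefinableOver.

(** * Saturation *)

Section Saturation.
Variables (L : language) (M : structure L) (kappa : Type).
Hypothesis kappa_nat : small kappa [set: nat].
Hypothesis satM : saturated M kappa.

(** The type to realise consists of the formulas implied by some [F j]; directedness makes it
    finitely satisfiable. *)
Lemma saturation1 (A : set M) (J : Type) (F : J -> (unit -> M) -> Prop) :
  small kappa A -> inhabited J ->
  (forall i j, exists k, forall x, F k x -> F i x /\ F j x) ->
  (forall j, definable_over A (F j)) -> (forall j, exists x, F j x) ->
  exists x, forall j, F j x.
Proof.
move=> sA J0 dir dF neF.
pose p := [set phi : formula L (unit + A) | exists j, forall x, F j x -> holds x phi].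
have [|x xp] := @satM A p sA.
  move=> q qp fq.
  have [||j jP] := @finite_set_directed _ J q
      (fun phi j => forall x, F j x -> holds x phi) fq J0.
  - move=> i j; have [k kP] := dir i j; exists k => phi [H|H] x /kP[? ?]; exact: H.
  - by move=> phi /qp.
  by have [x Fx] := neF j; exists x => phi /jP; apply.
exists x => j; have [phi phiP] := dF j; apply/phiP; apply: xp.
by exists j => y /phiP.
Qed.

(** The entries are chosen one at a time, each so that every [F j] stays satisfiable with the
    entries chosen so far held fixed. Since [F j] reads only finitely many entries, it holds in the
    limit. *)
Lemma saturation_nat (A : set M) (J : Type) (F : J -> (nat -> M) -> Prop) :
  small kappa A -> inhabited J ->
  (forall i j, exists k, forall x, F k x -> F i x /\ F j x) ->
  (forall j, definable_over A (F j)) -> (forall j, exists x, F j x) ->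
  exists x, forall j, F j x.
Proof.
move=> sA J0 dir dF neF; have [m0] := carrier_inhabited M.
pose splice n (m y : nat -> M) i := if i < n then m i else y i.
pose upd n (m : nat -> M) (a : M) i := if i == n then a else m i.
have bound j : exists b, depends [set i | i < b] (F j).
  have [S fS dS] := definable_over_support (dF j).
  have [n [f [_ fP]]] := finite_set_enum fS.
  exists (\max_i (f i)).+1; apply: dependsS dS => k /fP[i <-] /=.
  by rewrite ltnS; exact: (leq_bigmax i).
have step n m : exists a, (forall j, exists y, F j (splice n m y)) ->
    forall j, exists y, F j (splice n.+1 (upd n m a) y).
  have [H|H] := pselect (forall j, exists y, F j (splice n m y)); last by exists m0.
  pose G j (u : unit -> M) := exists y, F j (splice n.+1 (upd n m (u tt)) y).
  have [|||||u uP] := @saturation1 (A `|` range m) J G.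
  - apply: smallU => //; exact: small_range.
  - by [].
  - move=> i j; have [k kP] := dir i j; exists k => u [y /kP[? ?]].
    by split; exists y.
  - move=> j; have [b bP] := bound j.
    have dF' := definable_overS (@subsetUl _ A (range m)) (dF j).
    have [|Q dQ QP] := class_factor (definable_over_class _)
        (f := @nat_of_ord b) bP _ dF'.
      by move=> k kb; exists (Ordinal kb).
    pose g (i : 'I_b) : unit + 'I_b + nat :=
      if i < n then inr (i : nat) else if i == n :> nat then inl (inl tt)
      else inl (inr i).
    have dQ' := definable_over_inst (y := m) (subset_refl (A := A `|` range m))
      (fun k => or_intror (imageT m k))
      (class_rename (definable_over_class _) g dQ).
    have := class_ex (definable_over_class _) dQ'.
    apply: class_iff => u; split=> [[z Qz]|[y Fy]].
      exists (fun k => if insub k is Some i then z i else m0).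
      rewrite QP; move: Qz; congr Q; apply/funext => i /=.
      rewrite /splice /upd ltnS leq_eqVlt /g.
      by case: (ltngtP i n) => /= h; rewrite ?(valK i).
    exists (fun i : 'I_b => y i); move: Fy; rewrite QP; congr Q; apply/funext => i /=.
    rewrite /splice /upd ltnS leq_eqVlt /g.
    by case: (ltngtP i n) => /=.
  - move=> j; have [y Fy] := H j; exists (fun=> y n), y; move: Fy; congr (F j).
    apply/funext => i; rewrite /splice /upd ltnS [i <= n]leq_eqVlt.
    by case: (ltngtP i n) => //= ->.
  by exists (u tt) => _ j; exact: uP.
have /choice[g gP] : forall p : nat * (nat -> M), exists a,
    (forall j, exists y, F j (splice p.1 p.2 y)) ->
    forall j, exists y, F j (splice p.1.+1 (upd p.1 p.2 a) y).
  by move=> [n m]; exact: step.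
pose mm := fix mm n := if n is n'.+1 then upd n' (mm n') (g (n', mm n')) else fun=> m0.
have mmP n j : exists y, F j (splice n (mm n) y).
  elim: n j => [|n IH] j.
    by have [y Fy] := neF j; exists y; move: Fy; congr (F j); exact/funext.
  exact: (gP (n, mm n)).
pose m i := mm i.+1 i.
have mmE n i : i < n -> mm n i = m i.
  elim: n => // n IH; rewrite ltnS leq_eqVlt => /orP[/eqP ->//|h].
  by rewrite /= /upd ltn_eqF// IH.
exists m => j; have [b bP] := bound j; have [y] := mmP b j.
by rewrite (bP _ m)// => i /= ib; rewrite /splice ib mmE.
Qed.

(** The form of compactness used below. A partial type is presented by the conditions that are [ok],
    closed under common strengthening; tuples indexed by a countable type are coded by sequences. *)
Lemma saturation (X : countType) (A : set M) (J : Type) (ok : J -> Prop)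
    (F : J -> (X -> M) -> Prop) :
  small kappa A -> (exists j, ok j) ->
  (forall i j, ok i -> ok j -> exists2 k, ok k & forall x, F k x -> F i x /\ F j x) ->
  (forall j, ok j -> definable_over A (F j)) -> (forall j, ok j -> exists x, F j x) ->
  exists x, forall j, ok j -> F j x.
Proof.
move=> sA [j0 ok0] dir dF neF; have [m0] := carrier_inhabited M.
have [||||v vP] := @saturation_nat A {j | ok j}
    (fun j v => F (sval j) (v \o choice.pickle)) sA.
- by constructor; exists j0.
- move=> [i oki] [j okj]; have [k okk kP] := dir i j oki okj.
  by exists (exist _ k okk) => x /kP.
- move=> [j okj] /=; exact: (class_rename (definable_over_class A) _ (dF j okj)).
- move=> [j okj] /=; have [x Fx] := neF j okj.
  exists (fun k => if choice.unpickle k is Some i then x i else m0).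
  by move: Fx; congr (F j); apply/funext => i /=; rewrite choice.pickleK.
by exists (v \o choice.pickle) => j okj; exact: vP (exist _ j okj).
Qed.

End Saturation.

(** * Dividing *)

Definition sum_map (X X' Y Y' : Type) (f : X -> X') (g : Y -> Y') (s : X + Y) : X' + Y' :=
  match s with inl x => inl (f x) | inr y => inr (g y) end.

Lemma join_sum_map (U X X' Y Y' : Type) (f : X -> X') (g : Y -> Y') (x : X' -> U) (y : Y' -> U) :
  join x y \o sum_map f g = join (x \o f) (y \o g).
Proof. by apply/funext => -[]. Qed.

Section Dividing.
Variables (L : language) (M : structure L) (C : set M).

Definition divides_pred (X Y : Type) (psi : (X + Y -> M) -> Prop) (e : Y -> M) : Prop :=
  exists (k : nat) (b : nat -> Y -> M), (forall i, equiv_over C e (b i)) /\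
    forall s : 'I_k -> nat, injective s ->
      ~ exists x : X -> M, forall i, psi (join x (b (s i))).

Lemma divides_predP (X Y : Type) (phi : formula L ((X + Y) + C)) (e : Y -> M) :
  divides phi e <-> divides_pred (fun v => holds v phi) e.
Proof.
split=> -[k [b [be bk]]]; exists k, b; split=> // i.
  by apply/equiv_overP; rewrite be.
by have /equiv_overP -> := be i.
Qed.

(** The type of [x] over [C] and [y] does not divide over [C]. Forking is avoided here because left
    transitivity can be proved for dividing without further assumptions on [C] than smallness. *)
Definition indep_div (X Y : Type) (x : X -> M) (y : Y -> M) : Prop :=
  forall psi : (X + Y -> M) -> Prop, definable_over C psi -> psi (join x y) ->
    ~ divides_pred psi y.

Lemma divides_pred_rename X X' Y Y' (f : X' -> X) (g : Y' -> Y)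
    (psi : (X' + Y' -> M) -> Prop) (e : Y -> M) :
  divides_pred (fun v => psi (v \o sum_map f g)) e -> injective f ->
  divides_pred psi (e \o g).
Proof.
move=> [k [b [be bk]]] finj; exists k, (fun i => b i \o g); split=> [i|s sinj [x xP]].
  exact: equiv_over_rename.
have [z zf] := extend_along x finj.
by apply: bk sinj _; exists z => i; rewrite join_sum_map zf.
Qed.

Lemma divides_pred_weaken X X' Y (f : X' -> X) (psi : (X' + Y -> M) -> Prop) (e : Y -> M) :
  divides_pred psi e -> divides_pred (fun v => psi (v \o sum_map f id)) e.
Proof.
move=> [k [b [be bk]]]; exists k, b; split=> // s sinj [x xP].
by apply: bk sinj _; exists (x \o f) => i; have := xP i; rewrite join_sum_map.
Qed.

Lemma divides_pred_equiv X Y (psi : (X + Y -> M) -> Prop) (e e' : Y -> M) :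
  equiv_over C e e' -> divides_pred psi e -> divides_pred psi e'.
Proof.
move=> ee' [k [b [be bk]]]; exists k, b; split=> // i.
by apply: equiv_over_trans (be i); exact: equiv_over_sym.
Qed.

Lemma indep_div_renameL X X' Y (f : X' -> X) (x : X -> M) (y : Y -> M) :
  indep_div x y -> indep_div (x \o f) y.
Proof.
move=> xy psi dpsi psixy /(divides_pred_weaken f); apply: xy.
  exact: (class_rename (definable_over_class C)).
by rewrite join_sum_map.
Qed.

Lemma indep_div_bijR X Y Y' (f : Y' -> Y) (g : Y -> Y') (x : X -> M) (y : Y -> M) :
  cancel f g -> cancel g f -> indep_div x y -> indep_div x (y \o f).
Proof.
move=> fK gK xy psi dpsi psixy [k [b [be bk]]].
apply: (xy (fun v => psi (v \o sum_map id f))).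
- exact: (class_rename (definable_over_class C)).
- by rewrite join_sum_map.
exists k, (fun i => b i \o g); split=> [i|s sinj [z zP]].
  have := equiv_over_rename (f := g) (be i).
  by rewrite (_ : (y \o f) \o g = y)//; apply/funext => j /=; rewrite gK.
apply: bk sinj _; exists z => i; have := zP i; rewrite join_sum_map; congr (psi (join _ _)).
by apply/funext => j /=; rewrite fK.
Qed.

Lemma indep_div_eqR X Y Y' (f : Y' -> Y) (g : Y -> Y') (x : X -> M) (y : Y -> M)
    (y' : Y' -> M) :
  cancel f g -> cancel g f -> y' = y \o f -> indep_div x y -> indep_div x y'.
Proof. by move=> fK gK ->; exact: indep_div_bijR. Qed.

End Dividing.

Section Monster.
Variables (L : language) (M : structure L) (kappa : Type) (C : set M).
Hypothesis kappa_nat : small kappa [set: nat].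
Hypothesis satM : saturated M kappa.
Hypothesis smallC : small kappa C.

Notation defC := (definable_over C).
Let dcl := definable_over_class C.

Lemma definable_exT X Z (P : (X + Z -> M) -> Prop) :
  defC P -> defC (fun x => exists z : Z -> M, P (join x z)).
Proof. exact: class_exT dcl (@definable_over_support L M C) _ _ _. Qed.

(* Moves a dividing sequence over further parameters [z]: if the finite part
   [P] of the type of [e] over [C, z] could not be satisfied along an
   inconsistent sequence, then [P] would still hold along the given dividing
   sequence for some [z'], contradicting the choice of [z']. *)
Lemma dividing_sequence_over (X Z : Type) (Y : countType) (z : Z -> M) (e : Y -> M)
    (psi : (X + Y -> M) -> Prop) :
  small kappa (range z) -> defC psi -> indep_div C z e -> divides_pred C psi e ->
  exists (k : nat) (b : nat -> Y -> M),
    (forall i, equiv_over C (join z e) (join z (b i))) /\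
    forall s : 'I_k -> nat, injective s ->
      ~ exists x : X -> M, forall i, psi (join x (b (s i))).
Proof.
move=> sz dpsi ze [k [b [be bk]]].
pose pr (j : nat) (t : Z + Y) : (nat * Y) + Z :=
  match t with inl t => inr t | inr y => inl (j, y) end.
pose ps (j : nat) (t : X + Y) : ((nat * Y) + Z) + X :=
  match t with inl t => inr t | inr y => inl (inl (j, y)) end.
(* A finite piece of the goal: the first [p.2] terms satisfy [p.1] together with [z], and are
   [k]-inconsistent for [psi]. *)
pose Fv (p : ((Z + Y -> M) -> Prop) * nat) (v : (nat * Y) + Z -> M) : Prop :=
  (forall j : 'I_p.2, p.1 (v \o pr j)) /\
  (forall s : {ffun 'I_k -> 'I_p.2}, injective s ->
    ~ exists x : X -> M, forall i, psi (join v x \o ps (s i))).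
have dFv P K : defC P -> defC (Fv (P, K)).
  move=> dP; apply: (class_and dcl).
    by apply: (class_bigand dcl) => j; exact: (class_rename dcl).
  apply: (class_bigand dcl) => s; apply: (class_imp dcl); first exact: (class_const dcl).
  apply: (class_not dcl); apply: (definable_exT (P := fun v => forall i, psi (v \o ps (s i)))).
  by apply: (class_bigand dcl) => i; exact: (class_rename dcl).
pose ok (p : ((Z + Y -> M) -> Prop) * nat) := defC p.1 /\ p.1 (join z e).
have [|||||y yP] := @saturation _ _ _ kappa_nat satM _ (C `|` range z) _ ok
   (fun p y => Fv p (join y z)).
- exact: smallU.
- by exists (fun=> True, 0); split=> //; exact: (class_true dcl).
- move=> [P K] [P' K'] [/= dP Pze] [/= dP' P'ze].
  exists (fun v => P v /\ P' v, maxn K K'); first by split=> //; exact: (class_and dcl).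
  have sub K1 K2 (le12 : K1 <= K2) (P1 P2 : (Z + Y -> M) -> Prop) y :
      (forall v, P2 v -> P1 v) -> Fv (P2, K2) y -> Fv (P1, K1) y.
    move=> P21 [H1 H2]; split=> /= [j|s sinj].
      by apply: P21; exact: H1 (widen_ord le12 j).
    move=> [x xP]; apply: (H2 [ffun i => widen_ord le12 (s i)]).
      move=> i i' /=; rewrite !ffunE => /(congr1 val) /= h; apply: sinj.
      exact: val_inj.
    by exists x => i; rewrite ffunE /=; exact: xP.
  move=> y Fy; split; [apply: sub Fy; [exact: leq_maxl|by move=> v []]
                      |apply: sub Fy; [exact: leq_maxr|by move=> v []]].
- move=> [P K] [/= dP _]; apply: definable_over_inst (dFv _ _ dP) => [a|t].
    by left.
  by right; exists t.
- move=> [P K] [/= dP Pze]; apply: contrapT => nF.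
  pose xi (z' : Z -> M) := exists y : nat * Y -> M, Fv (P, K) (join y z').
  have dxi : defC xi.
    have := definable_exT (P := fun v => Fv (P, K) (v \o
      (fun t => match t with inl y => inr y | inr t => inl t end))) _.
    move=> /(_ (class_rename dcl _ (dFv _ _ dP))).
    apply: class_iff => z'; split=> -[y Fy]; exists y; move: Fy; congr Fv;
    by apply/funext => -[].
  apply: (ze (fun v => P v /\ ~ xi (v \o inl))).
  + apply: (class_and dcl) => //; apply: (class_not dcl).
    exact: (class_rename dcl).
  + by split.
  (* The first [K] of these terms would witness [xi z']. One more term is taken so that, for [K = 0]
     too, some place asserts [~ xi z']. *)
  exists K.+1, b; split=> // s sinj [z' z'P].
  have [_ /= nxi] := z'P ord0; apply: nxi.
  exists (fun p => b (s (inord p.1)) p.2); split=> /= [j|s' s'inj [x xP]].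
    have [+ _] := z'P (inord j); congr P; apply/funext => -[] //.
  apply: (bk (fun i => s (inord (s' i)))).
    move=> i i' /sinj /(congr1 val); rewrite /= !inordK => [/val_inj/s'inj//||];
    exact: ltnW (ltn_ord _).
  exists x => i; have := xP i; congr psi; by apply/funext => -[].
exists k, (fun j t => y (j, t)); split=> [i P dP Pze|s sinj [x xP]].
  have [/(_ ord_max) + _] := yP (P, i.+1) (conj dP Pze).
  by congr P; apply/funext => -[].
pose K := (\max_i s i).+1.
have sK i : s i < K by rewrite ltnS; exact: (leq_bigmax i).
have [_ /(_ [ffun i => Ordinal (sK i)])] :=
  yP (fun=> True, K) (conj (class_true dcl _) I).
apply; first by move=> i i'; rewrite !ffunE => -[/sinj].
exists x => i; rewrite ffunE; have := xP i; congr psi; by apply/funext => -[].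
Qed.

(** Because [a] is independent from [b], a dividing sequence of [b] can be moved over [a]. It then
    becomes a dividing sequence of the pair, against the independence of [a'] from [a, b]. *)
Lemma indep_div_trans (X X' : Type) (Y : countType) (a : X -> M) (a' : X' -> M) (b : Y -> M) :
  small kappa (range a) -> indep_div C a b -> indep_div C a' (join a b) ->
  indep_div C (join a a') b.
Proof.
move=> sa ab a'ab psi dpsi psiab divpsi.
have [k [c [cb ck]]] := dividing_sequence_over sa dpsi ab divpsi.
pose g (t : (X + X') + Y) : X' + (X + Y) := match t with
  | inl (inl x) => inr (inl x) | inl (inr x) => inl x | inr y => inr (inr y) end.
have gE x' x y : join x' (join x y) \o g = join (join x x') y.
  by apply/funext => -[[]|].
apply: (a'ab (fun v => psi (v \o g))); first exact: (class_rename dcl).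
  by rewrite gE.
exists k, (fun i => join a (c i)); split=> // s sinj [x' x'P].
by apply: ck sinj _; exists (join a x') => i; have := x'P i; rewrite gE.
Qed.

End Monster.

(** * Independence property *)

Section Nip.
Variables (L : language) (M : structure L) (kappa : Type) (C : set M).
Hypothesis kappa_nat : small kappa [set: nat].
Hypothesis satM : saturated M kappa.
Hypothesis smallC : small kappa C.
Hypothesis NIP : forall n m (phi : formula L ('I_n + 'I_m)), ~ has_IP M phi.

Notation defC := (definable_over C).
Let dcl := definable_over_class C.

Definition shattered (X Y T : Type) (psi : (X + Y -> M) -> Prop) (c : T -> Y -> M) : Prop :=
  forall S : T -> Prop, exists x : X -> M, forall t, psi (join x (c t)) <-> S t.

(** [has_IP] asks for finite tuples and no parameters. The finitely many variables of [Y] and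
    parameters from [C] that occur in the formula are put into the second block; its spare index
    keeps it inhabited, so that symbols that do not occur can also be renamed. *)
Lemma infinite_not_shattered (X : finType) (Y : Type) (psi : (X + Y -> M) -> Prop)
    (c : nat -> Y -> M) : defC psi -> ~ shattered psi c.
Proof.
move=> [phi phiP] shat.
have [S fS dS] := sat_support M phi; have [k [f [_ fP]]] := finite_set_enum fS.
pose g (j : 'I_k.+1) : option ((X + Y) + C) := omap f (insub (val j)).
have /choice[idx idxP] : forall v, exists j, S v -> g j = Some v.
  move=> v; have [/fP[i <-]|nS] := pselect (S v); last by exists ord0.
  by exists (widen_ord (leqnSn k) i) => _; rewrite /g /= (valK i).
pose r (v : (X + Y) + C) : 'I_#|X| + 'I_k.+1 :=
  if v is inl (inl x) then inl (enum_rank x) else inr (idx v).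
have [m0] := carrier_inhabited M.
have [b bP] := choice shat.
apply: (@NIP _ _ (rename phi r)).
exists (fun i j => match g j with
  | Some (inl (inr y)) => c i y | Some (inr a) => val a | _ => m0 end).
exists (fun T j => b T (enum_val j)) => T i.
rewrite sat_rename -bP -phiP /holds -propeqE.
apply: dS => -[[x|y]|a] Sv /=; rewrite ?enum_rankK ?(idxP _ Sv)//.
Qed.

(** Compactness twice: if there were no bound, an infinite sequence would have all its finite
    initial segments shattered, and then each subset of [nat] would be cut out by some [x]. *)
Lemma not_shattered_bound (X Y : finType) (psi : (X + Y -> M) -> Prop) : defC psi ->
  exists N, forall (T : finType) (c : T -> Y -> M), N <= #|T| -> ~ shattered psi c.
Proof.
move=> dpsi; apply: contrapT => /forallNP H.
have {}H N : exists c : 'I_N -> Y -> M, shattered psi c.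
  have /existsNP[T /existsNP[c /not_implyP[NT /contrapT shat]]] := H N.
  exists (fun i => c (enum_val (widen_ord NT i))) => S.
  have [x xP] := shat (fun t => exists2 i, enum_val (widen_ord NT i) = t & S i).
  exists x => i; rewrite xP; split=> [[j /enum_val_inj/(congr1 val)/= /val_inj <-]//|Si].
  by exists i.
pose F N (y : nat * Y -> M) := forall S : {ffun 'I_N -> bool}, exists x : X -> M,
  forall i : 'I_N, psi (join x (fun t => y (val i, t))) <-> S i.
have [||||y yP] := @saturation _ _ _ kappa_nat satM _ C _ (fun _ => True) F smallC.
- by exists 0.
- move=> i j _ _; exists (maxn i j) => // y Fy.
  have sub n m (nm : n <= m) : F m y -> F n y.
    move=> Fm S; have [x xP] := Fm [ffun k => if insub (val k) is Some j then S j else false].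
    by exists x => k; rewrite (xP (widen_ord nm k)) ffunE /= (valK k).
  by split; apply: sub Fy; [exact: leq_maxl|exact: leq_maxr].
- move=> N _; apply: (class_bigand dcl) => S.
  pose h (i : nat) (t : X + Y) : (nat * Y) + X :=
    match t with inl x => inr x | inr y => inl (i, y) end.
  have hE i y x : join y x \o h i = join x (fun t => y (i, t)) by apply/funext => -[].
  have dQ : defC (fun v => forall i : 'I_N, psi (v \o h i) <-> S i).
    apply: (class_bigand dcl) => i; apply: (class_eqv dcl); last exact: (class_const dcl).
    exact: (class_rename dcl).
  apply: class_iff (class_ex dcl dQ) => y.
  by split=> -[x xP]; exists x => i; have := xP i; rewrite hE.
- move=> N _; have [c shat] := H N; have [m0] := carrier_inhabited M.
  exists (fun p => if insub p.1 is Some i then c i p.2 else m0) => S.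
  have [x xP] := shat (fun i => S i); exists x => i; rewrite -xP.
  by under [X in join x X]funext => t do rewrite (valK i).
apply: (infinite_not_shattered (c := fun i t => y (i, t)) dpsi) => S.
pose A := C `|` range y.
have [|||||x xP] := @saturation _ _ _ kappa_nat satM X A _ (fun _ => True)
  (fun N x => forall i : 'I_N, psi (join x (fun t => y (val i, t))) <-> S i).
- apply: smallU => //; exact: small_range.
- by exists 0.
- move=> i j _ _; exists (maxn i j) => // x xP; split=> k.
    exact: xP (widen_ord (leq_maxl _ _) k).
  exact: xP (widen_ord (leq_maxr _ _) k).
- move=> N _; have dA := definable_over_class A.
  apply: (class_bigand dA) => i; apply: (class_eqv dA); last exact: (class_const dA).
  by apply: definable_over_inst dpsi => [a|t]; [left|right; exists (val i, t)].
- move=> N _; have [x xP] := yP N I [ffun i => `[< S (val i) >]].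
  by exists x => i; rewrite xP ffunE asboolE.
by exists x => i; exact: xP i.+1 I ord_max.
Qed.

Definition other_terms (T : eqType) (Y : Type) (c : T -> Y -> M) (t : T)
    (z : {s : T | s != t} * Y) : M := c (val z.1) z.2.
Arguments other_terms {T Y} c t z.

(* If a pattern on the terms [c s], [s != t], can be completed positively at
   [c t] but not negatively, the formula saying so does not divide, yet along
   a dividing sequence it asks for one [x] satisfying all instances of [psi]. *)
Lemma independent_terms_shattered (X Y : Type) (T : finType)
    (psi : (X + Y -> M) -> Prop) (c : T -> Y -> M) :
  defC psi -> (forall t, divides_pred C psi (c t)) ->
  (forall t, indep_div C (other_terms c t) (c t)) ->
  (exists x, forall t, psi (join x (c t))) -> shattered psi c.
Proof.
move=> dpsi divc indc [x0 x0P] S0.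
suff shat (S : {set T}) : exists x, forall t, psi (join x (c t)) <-> t \in S.
  have [x xP] := shat [set t | `[< S0 t >]]%SET; exists x => t.
  by rewrite xP inE asboolE.
(* Induction on the number of places where [psi] must fail: the pattern [S] is reached from
   [t0 |: S] by making the place [t0] negative. *)
move: {2}(#|~: S|) (erefl (#|~: S|)) => n; elim: n S => [|n IH] S Sn.
  exists x0 => t; split=> // _.
  by have := card0_eq Sn t; rewrite inE => /negbFE.
have [t0 t0S] : exists t0, t0 \in ~: S by apply/card_gt0P; rewrite Sn.
rewrite inE in t0S; have [x1 x1P] : exists x, forall t, psi (join x (c t)) <-> t \in (t0 |: S)%SET.
  apply: IH; move: (cardsC S) (cardsC (t0 |: S)%SET); rewrite Sn cardsU1 t0S.
  by move=> <-; rewrite add1n addSnnS => /addnI [].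
apply: contrapT => nx.
pose Z := ({s : T | s != t0} * Y)%type.
pose h (s : {s : T | s != t0}) (v : X + Y) : (Z + Y) + X :=
  match v with inl x => inr x | inr y => inl (inl (s, y)) end.
pose h0 (v : X + Y) : (Z + Y) + X := match v with inl x => inr x | inr y => inl (inr y) end.
have hE s z y x : join (join z y) x \o h s = join x (fun t => z (s, t)).
  by apply/funext => -[].
have h0E (z : Z -> M) y x : join (join z y) x \o h0 = join x y by apply/funext => -[].
pose theta v := forall s, psi (v \o h s) <-> val s \in S.
have dtheta : defC theta.
  apply: (class_bigand dcl) => s; apply: (class_eqv dcl); last exact: (class_const dcl).
  exact: (class_rename dcl).
have dpsi0 : defC (fun v => psi (v \o h0)) by exact: (class_rename dcl).
apply: (indc t0 (fun w => (exists x, theta (join w x) /\ psi (join w x \o h0)) /\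
  ~ exists x, theta (join w x) /\ ~ psi (join w x \o h0))).
- apply: (class_and dcl); last apply: (class_not dcl).
    apply: (definable_exT (P := fun v => theta v /\ psi (v \o h0))).
    exact: (class_and dcl).
  apply: (definable_exT (P := fun v => theta v /\ ~ psi (v \o h0))).
  by apply: (class_and dcl) => //; exact: (class_not dcl).
- split.
    exists x1; split=> [s|]; last by rewrite h0E x1P !inE eqxx.
    by rewrite hE x1P !inE (negbTE (valP s)).
  move=> [x []]; rewrite h0E => th npsi; apply: nx; exists x => t.
  have [->|tt0] := eqVneq t t0; first by rewrite (negbTE t0S); split.
  by have := th (exist _ t tt0); rewrite hE.
have [k [b [be bk]]] := divc t0.
exists k, b; split=> // s sinj [z zP].
case: k => [|k] in s sinj bk zP *.
  by apply: (bk s sinj); exists x0 => -[].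
(* An [x] with the pattern exists by the positive half at place 0. As the pattern depends on [z]
   only, the negative half at each place forces [psi] there, for this same [x]. *)
have [[x [th _]] _] := zP ord0; apply: (bk s sinj); exists x => i.
apply: contrapT => npsi; have [_] := zP i; apply; exists x; split; last by rewrite h0E.
by move=> s'; have := th s'; rewrite !hE.
Qed.

End Nip.
Arguments other_terms {L M T Y} c t z.

(** * Extension bases *)

Section ExtensionBase.
Variables (L : language) (M : structure L) (kappa : Type) (C : set M).
Hypothesis kappa_nat : small kappa [set: nat].
Hypothesis satM : saturated M kappa.
Hypothesis smallC : small kappa C.
Hypothesis baseC : extension_base C.

Notation defC := (definable_over C).
Let dcl := definable_over_class C.

(** [{classic _}] gives predicates a decidable equality, so that finite sets of conditions can be
    lists. *)
Lemma definable_seq_factor (X : Type) (l : seq {classic (X -> M) -> Prop}) :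
  (forall P, P \in l -> defC P) ->
  exists p (f : 'I_p -> X), injective f /\ forall P, P \in l ->
    depends [set k | exists i, f i = k] P.
Proof.
move=> dl; have : exists2 S, finite_set S & forall P, P \in l -> depends S P.
  elim: l dl => [|P l IH] dl; first by exists set0.
  have [S fS dS] := IH (fun Q Ql => dl Q (mem_behead (s := P :: l) Ql)).
  have [S' fS' dS'] := definable_over_support (dl P (mem_head _ _)).
  exists (S `|` S'); first by rewrite finite_setU.
  move=> Q; rewrite inE => /orP[/eqP ->|/dS].
    by apply: dependsS dS' => k; right.
  by apply: dependsS => k; left.
move=> [S fS dS]; have [p [f [finj fP]]] := finite_set_enum fS.
by exists p, f; split=> // P Pl; apply: dependsS (dS P Pl) => k /fP.
Qed.

(** The place where [extension_base] is applied: the type of [x0] over [C] contains [Q] and does not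
    fork, so it does not imply a disjunction of dividing formulas. Since [extension_base] is about
    finite tuples, [x0] and [z] are first cut down to a finite support. *)
Lemma avoid_dividing (X Z : Type) (x0 : X -> M) (z : Z -> M)
    (l : seq {classic (X + Z -> M) -> Prop}) (Q : (X -> M) -> Prop) :
  (forall psi, psi \in l -> defC psi /\ divides_pred C psi z) -> defC Q -> Q x0 ->
  exists2 x, Q x & forall psi, psi \in l -> ~ psi (join x z).
Proof.
move=> lP dQ Qx0.
have [S [fS dSQ dSl]] : exists S : set (X + Z), [/\ finite_set S,
    depends S (fun v => Q (v \o inl)) & forall psi, psi \in l -> depends S psi].
  have [] := @definable_seq_factor _ ((fun v => Q (v \o inl)) :: l).
    move=> P; rewrite inE => /orP[/eqP ->|/lP[]//].
    exact: (class_rename dcl inl dQ).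
  move=> p [f [_ fP]]; exists [set k | exists i, f i = k]; split.
  - suff -> : [set k | exists i, f i = k] = f @` [set: 'I_p] by exact: finite_image.
    by apply/seteqP; split=> k [i]; [exists i|exists i].
  - by apply: fP; rewrite mem_head.
  - by move=> psi psil; apply: fP; rewrite inE psil orbT.
have [p [f [finj fP]]] := finite_set_enum
  (bigcup_finite fS (fun o _ => match o return
     finite_set (if o is inl k then [set k] else set0 : set X) with
     | inl k => finite_set1 k | inr _ => finite_set0 X end)).
have [q [g [_ gP]]] := finite_set_enum
  (bigcup_finite fS (fun o _ => match o return
     finite_set (if o is inr k then [set k] else set0 : set Z) with
     | inr k => finite_set1 k | inl _ => finite_set0 Z end)).
have cover k : S k -> exists i, sum_map f g i = k.
  case: k => k Sk.
    have [|i <-] := (fP k).1; first by exists (inl k).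
    by exists (inl i).
  have [|i <-] := (gP k).1; first by exists (inr k).
  by exists (inr i).
pose psi (i : 'I_(size l)) := tnth (in_tuple l) i.
have psil i : psi i \in l by exact: mem_tnth.
have /choice[psi' psi'P] : forall i, exists phi : formula L (('I_p + 'I_q) + C),
    forall v, psi i v <-> holds (v \o sum_map f g) phi.
  move=> i; have [dpsi _] := lP _ (psil i).
  have [psi' [phi phiP] psiE] := class_factor dcl (dSl _ (psil i)) cover dpsi.
  by exists phi => v; rewrite phiP psiE.
have compl : complete_type (tp C (x0 \o f)).
  split=> [r rp _|phi]; first by exists (x0 \o f) => phi /rp.
  by have [?|?] := pselect (holds (x0 \o f) phi); [left|right].
apply: contrapT => nx; apply: (baseC compl).
exists (size l), (fun _ => q), psi', (fun _ => z \o g); split=> [i|x xp].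
  apply/divides_predP; apply: (divides_pred_rename (f := f)) => //.
  have [_] := lP _ (psil i); congr (divides_pred C _ z).
  by apply/funext => v; apply/propext; rewrite psi'P.
apply: contrapT => /forallNP nhold; apply: nx.
have [v vf] := extend_along x finj; exists v.
  have dSQ' : depends [set k | S (inl k)] Q.
    have [m0] := carrier_inhabited M.
    move=> w w' ww'; apply: (dSQ (join w (fun=> m0)) (join w' (fun=> m0))).
    by move=> -[k|k] Sk //=; exact: ww'.
  have [|Q' [phi phiP] QE] := class_factor (f := f) dcl dSQ' _ dQ.
    by move=> k Sk; apply/fP; exists (inl k).
  by rewrite QE vf -phiP; apply: xp; rewrite /= /tp /= phiP -QE.
move=> th thl; have [i ->] : exists i, th = psi i by apply/tnthP.
by rewrite psi'P join_sum_map vf; exact: nhold.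
Qed.

(** It is [z] that becomes independent from the conjugate of [e]. If no conjugate would do, the
    formula of [z] saying so could be realised, by [avoid_dividing], by some [z'] for which [e]
    itself does. *)
Lemma extend_independently (Z : Type) (Y : countType) (z : Z -> M) (e : Y -> M) :
  small kappa (range z) -> exists2 e', equiv_over C e e' & indep_div C z e'.
Proof.
move=> sz.
pose ok (p : ((Y -> M) -> Prop) * seq {classic (Z + Y -> M) -> Prop}) :=
  [/\ defC p.1, p.1 e & forall th, th \in p.2 -> defC th /\ divides_pred C th e].
have [|||||e' e'P] := @saturation _ _ _ kappa_nat satM _ (C `|` range z) _ ok
  (fun p y => p.1 y /\ forall th, th \in p.2 -> ~ th (join z y)).
- exact: smallU.
- by exists (fun=> True, [::]); split=> //; exact: (class_true dcl).
- move=> [P l] [P' l'] [/= dP Pe lP] [/= dP' P'e l'P].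
  exists (fun v => P v /\ P' v, l ++ l').
    split=> //=; first exact: (class_and dcl).
    by move=> th; rewrite mem_cat => /orP[/lP|/l'P].
  by move=> y [[Py P'y] thy]; split; split=> // th thl; apply: thy;
    rewrite mem_cat thl ?orbT.
- move=> [P l] [/= dP _ lP]; have dA := definable_over_class (C `|` range z).
  apply: (class_and dA); first by apply: definable_overS dP; left.
  apply: (class_bigand_seq dA) => th thl; apply: (class_not dA).
  pose g (t : Z + Y) : Y + Z := match t with inl x => inr x | inr y => inl y end.
  have [dth _] := lP th thl.
  have gE y : join y z \o g = join z y by apply/funext => -[].
  have := definable_over_inst (y := z) (@subsetUl _ C (range z))
    (fun k => or_intror (imageT z k)) (class_rename dcl g dth).
  by apply: class_iff => y; rewrite gE.
- move=> [P l] [/= dP Pe lP]; apply: contrapT => ny.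
  pose Q (z' : Z -> M) := ~ exists y, P y /\ forall th, th \in l -> ~ th (join z' y).
  have dQ : defC Q.
    apply: (class_not dcl).
    apply: (class_exT dcl (@definable_over_support _ _ C)
      (P := fun v => P (v \o inr) /\ forall th, th \in l -> ~ th v)).
    apply: (class_and dcl); first exact: (class_rename dcl).
    by apply: (class_bigand_seq dcl) => th /lP[? _]; exact: (class_not dcl).
  have [z' Qz' z'P] := avoid_dividing lP dQ ny.
  by apply: Qz'; exists e.
have ee' : equiv_over C e e'.
  move=> P dP Pe; have okP : ok (P, [::]) by split.
  by have [] := e'P _ okP.
exists e' => // th dth thze' divth.
have okth : ok (fun=> True, [:: th : {classic _}]).
  split=> //=; first exact: (class_true dcl).
  move=> th'; rewrite inE => /eqP ->; split=> //.
  by apply: divides_pred_equiv divth; exact: equiv_over_sym.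
by have [_ /(_ th)] := e'P _ okth; rewrite mem_head => /(_ isT).
Qed.

End ExtensionBase.

(** * Coheirs of a countable hull *)

Section Hull.
Variables (L : language) (M : structure L) (C : set M) (m0 : M).
Variable At : nat -> (nat -> M) -> Prop.
Hypothesis defAt : forall i, definable_over C (At i).

Notation defC := (definable_over C).
Let dcl := definable_over_class C.

(* A countable syntax, so that the hull below is countable whatever the
   cardinality of the language. [CImp] puts its premise on the even variables
   and its conclusion on the odd ones, which makes it possible to combine two
   predicates with unrelated substitutions. *)
Inductive code : Type :=
| CAt : nat -> code
| CFalse : code
| CImp : code -> code -> code
| CAll : seq nat -> code -> code.

(** [CAll] binds a list of indices with one common value, because the substitutions in
    [hull_definable] may let several indices stand for the same variable. *)
Fixpoint interp (c : code) (v : nat -> M) : Prop :=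
  match c with
  | CAt i => At i v
  | CFalse => False
  | CImp c c' => interp c (fun k => v k.*2) -> interp c' (fun k => v k.*2.+1)
  | CAll t c => forall m, interp c (fun k => if k \in t then m else v k)
  end.

Definition vars_of_nat (n : nat) : seq nat := odflt [::] (choice.unpickle n).

Lemma pickle_varsK : cancel choice.pickle vars_of_nat.
Proof. by move=> t; rewrite /vars_of_nat choice.pickleK. Qed.

(** Serves to number the codes. The labels 0 and 1 are taken, hence the shift by 2 for the list of
    bound indices. *)
Fixpoint tree_of_code (c : code) : GenTree.tree nat :=
  match c with
  | CAt i => GenTree.Leaf i
  | CFalse => GenTree.Node 0 [::]
  | CImp c c' => GenTree.Node 1 [:: tree_of_code c; tree_of_code c']
  | CAll t c => GenTree.Node (choice.pickle t).+2 [:: tree_of_code c]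
  end.

Fixpoint code_of_tree (t : GenTree.tree nat) : code :=
  match t with
  | GenTree.Leaf i => CAt i
  | GenTree.Node 1 [:: c; c'] => CImp (code_of_tree c) (code_of_tree c')
  | GenTree.Node n.+2 [:: c] => CAll (vars_of_nat n) (code_of_tree c)
  | _ => CFalse
  end.

Lemma tree_of_codeK : cancel tree_of_code code_of_tree.
Proof.
by elim=> [i||c IHc c' IHc'|t c IH] //=; rewrite ?IHc ?IHc' ?IH ?pickle_varsK.
Qed.

Lemma interp_definable c : defC (interp c).
Proof.
elim: c => [i||c IHc c' IHc'|t c IH] //=.
- exact: class_false.
- by apply: (class_imp dcl); exact: (class_rename dcl).
pose f k : option nat := if k \in t then None else Some k.
apply: class_iff (class_all1 dcl (class_rename dcl f IH)) => v.
have e m : oapp v m \o f = (fun k => if k \in t then m else v k).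
  by apply/funext => k /=; rewrite /f; case: ifP.
by split=> H m; have := H m; rewrite e.
Qed.

Lemma interp_bound c : exists b, depends [set k | k < b] (interp c).
Proof.
have [S fS dS] := definable_over_support (interp_definable c).
have [n [f [_ fP]]] := finite_set_enum fS.
exists (\max_i (f i)).+1; apply: dependsS dS => k /fP[i <-] /=.
by rewrite ltnS; exact: (leq_bigmax i).
Qed.

Definition skolem_of_nat (n : nat) : code * seq nat :=
  if choice.unpickle n is Some (c, t) then (code_of_tree c, t) else (CFalse, [::]).

Lemma pickle_skolemK c t : skolem_of_nat (choice.pickle (tree_of_code c, t)) = (c, t).
Proof. by rewrite /skolem_of_nat choice.pickleK tree_of_codeK. Qed.

Definition witness_of (P : M -> Prop) : M :=
  if pselect (exists m, P m) is left h then projT1 (cid h) else m0.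

Lemma witness_ofP P : (exists m, P m) -> P (witness_of P).
Proof. by move=> h; rewrite /witness_of; case: pselect => // h'; exact: projT2 (cid h'). Qed.

(* The terms of a countable language of Skolem functions: [Node n s], with [n]
   encoding [(c, t)], is a value of the variables in [t] satisfying [c] when
   the other variables have the values [s]. *)
Definition hull_term := GenTree.tree nat.

Fixpoint hull (t : hull_term) : M :=
  match t with
  | GenTree.Leaf _ => m0
  | GenTree.Node n s => witness_of (fun m => interp (skolem_of_nat n).1
      (fun k => if k \in (skolem_of_nat n).2 then m else nth m0 (map hull s) k))
  end.

Lemma small_hull kappa : small kappa [set: nat] -> small kappa (range hull).
Proof.
move=> kappa_nat; exact: small_range.
Qed.

(** Definability with parameters in the hull: [s] substitutes for each index a variable or a hull
    element. It may be total on [nat], since a code reads only finitely many indices. *)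
Definition hull_definable (X : Type) (P : (X -> M) -> Prop) : Prop :=
  exists (c : code) (s : nat -> X + hull_term),
    forall x, P x <-> interp c (fun k => join x hull (s k)).
Arguments hull_definable {X} P.

Let t0 : hull_term := GenTree.Leaf 0.

Lemma hull_definable_class : definable_class (@hull_definable).
Proof.
split.
- by move=> X; exists CFalse, (fun=> inr t0).
- move=> X P Q [c [s cP]] [c' [s' c'P]].
  exists (CImp c c'), (fun k => if odd k then s' k./2 else s k./2) => x /=.
  rewrite cP c'P.
  under [X in _ <-> (interp c X -> _)]funext => k do rewrite odd_double doubleK.
  under [X in _ <-> (_ -> interp c' X)]funext => k do
    rewrite /= odd_double /= uphalf_double.
  by [].
- move=> X P [c [s cP]]; have [b bP] := interp_bound c.
  exists (CAll [seq k <- iota 0 b | if s k is inl None then true else false] c).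
  exists (fun k => match s k with
    | inl (Some x) => inl x | inl None => inr t0 | inr t => inr t end) => x /=.
  suff e m : interp c (fun k => join (oapp x m) hull (s k)) =
      interp c (fun k => if k \in [seq k <- iota 0 b |
        if s k is inl None then true else false] then m else
        join x hull (match s k with
          | inl (Some x) => inl x | inl None => inr t0 | inr t => inr t end)).
    by split=> H m; have := H m; rewrite cP e.
  apply: bP => k /= kb; rewrite mem_filter mem_iota add0n kb andbT.
  by case: (s k) => [[|]|].
- move=> X Y P f [c [s cP]]; exists c, (fun k => sum_map f id (s k)) => y.
  by rewrite cP; split; congr interp; apply/funext => k; case: (s k).
Qed.

Let hcl := hull_definable_class.

Lemma hull_definable_inst X Y (P : (X + Y -> M) -> Prop) (x : X -> hull_term) :
  hull_definable P -> hull_definable (fun y => P (join (hull \o x) y)).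
Proof.
move=> [c [s cP]].
exists c, (fun k => match s k with
  | inl (inl k) => inr (x k) | inl (inr y) => inl y | inr t => inr t end) => y.
by rewrite cP; split; congr interp; apply/funext => k; case: (s k) => [[]|].
Qed.

Lemma hull_definable_over X (P : (X -> M) -> Prop) : hull_definable P ->
  exists2 Q : (hull_term + X -> M) -> Prop, defC Q & forall x, P x <-> Q (join hull x).
Proof.
move=> [c [s cP]].
exists (fun v => interp c (fun k => v (match s k with inl x => inr x | inr t => inl t end))).
  apply: (class_rename dcl (fun k => match s k with inl x => inr x | inr t => inl t end)).
  exact: interp_definable.
by move=> x; rewrite cP; split; congr interp; apply/funext => k; case: (s k).
Qed.

(** The Tarski-Vaught property: a Skolem term provides the witness for one variable, and finite
    tuples follow by induction. *)
Lemma hull_elementary (Z : finType) (P : (Z -> M) -> Prop) :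
  hull_definable P -> (exists z, P z) -> exists z : Z -> hull_term, P (hull \o z).
Proof.
have one (Q : (unit -> M) -> Prop) : hull_definable Q -> (exists u, Q u) ->
    exists t, Q (fun=> hull t).
  move=> [c [s cP]] [u Qu]; have [b bP] := interp_bound c.
  pose t := [seq k <- iota 0 b | if s k is inl tt then true else false].
  pose args := [seq (if s k is inr t then t else t0) | k <- iota 0 b].
  exists (GenTree.Node (choice.pickle (tree_of_code c, t)) args).
  have E m : interp c (fun k => if k \in t then m else nth m0 (map hull args) k) =
      interp c (fun k => join (fun=> m) hull (s k)).
    apply: bP => k /= kb; rewrite mem_filter mem_iota add0n kb andbT.
    rewrite -map_comp (nth_map 0) ?size_iota// nth_iota//= add0n.
    by case: (s k) => [[]|].
  rewrite cP -E /= pickle_skolemK; apply: (witness_ofP (P := fun m =>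
    interp c (fun k => if k \in t then m else nth m0 (map hull args) k))).
  by exists (u tt); rewrite E -cP; move: Qu; congr Q; apply/funext => -[].
have ord n (Q : ('I_n -> M) -> Prop) : hull_definable Q -> (exists z, Q z) ->
    exists z : 'I_n -> hull_term, Q (hull \o z).
  elim: n Q => [|n IH] Q dQ [z Qz].
    exists (fun=> t0); move: Qz; congr Q; apply/funext => -[] //.
  pose g (i : 'I_n.+1) : unit + 'I_n :=
    if unlift ord0 i is Some j then inr j else inl tt.
  have dQ' := class_rename hcl g dQ.
  have zE (z' : 'I_n.+1 -> M) :
      join (fun=> z' ord0) (z' \o lift ord0) \o g = z'.
    by apply/funext => i /=; rewrite /g; case: unliftP => [j|] ->.
  have [|t [w Qw]] := one _ (class_ex hcl dQ').
    by exists (fun=> z ord0), (z \o lift ord0); rewrite zE.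
  have [|w' Qw'] := IH _ (hull_definable_inst (fun=> t) dQ'); first by exists w.
  exists (fun i => if unlift ord0 i is Some j then w' j else t).
  move: Qw'; congr Q; apply/funext => i /=; rewrite /g.
  by case: unliftP.
move=> dP [z Pz].
have [|w Pw] := ord _ _ (class_rename hcl (@enum_rank Z) dP).
  by exists (z \o enum_val); move: Pz; congr P; apply/funext => i /=; rewrite enum_rankK.
by exists (w \o enum_rank).
Qed.

Definition hull_equiv (X : Type) (x y : X -> M) : Prop :=
  forall P : (X -> M) -> Prop, hull_definable P -> P x -> P y.

Lemma hull_equiv_sym X (x y : X -> M) : hull_equiv x y -> hull_equiv y x.
Proof.
move=> xy P dP Py; apply: contrapT => nPx.
by apply: (xy (fun x => ~ P x)) nPx Py; exact: (class_not hcl).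
Qed.

Lemma hull_equiv_trans X (x y z : X -> M) :
  hull_equiv x y -> hull_equiv y z -> hull_equiv x z.
Proof. by move=> xy yz P dP /(xy P dP)/(yz P dP). Qed.

Lemma hull_equiv_rename X Y (f : Y -> X) (x y : X -> M) :
  hull_equiv x y -> hull_equiv (x \o f) (y \o f).
Proof.
move=> xy P dP; apply: (xy (fun x => P (x \o f))).
exact: (class_rename hcl).
Qed.

(** The left tuple is the one whose type, over the hull and [y], is finitely satisfiable in the
    hull. *)
Definition coheir (X Y : Type) (x : X -> M) (y : Y -> M) : Prop :=
  forall P : (X + Y -> M) -> Prop, hull_definable P -> P (join x y) ->
    exists t : X -> hull_term, P (join (hull \o t) y).

Lemma coheir_rename X X' Y Y' (f : X' -> X) (g : Y' -> Y) (x : X -> M) (y : Y -> M) :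
  coheir x y -> coheir (x \o f) (y \o g).
Proof.
move=> xy P dP Pxy.
have [||t Pt] := xy (fun v => P (v \o sum_map f g)).
- exact: (class_rename hcl).
- by rewrite join_sum_map.
by exists (t \o f); move: Pt; rewrite join_sum_map.
Qed.

Lemma coheir_equiv X Y (x x' : X -> M) (y y' : Y -> M) :
  hull_equiv (join x y) (join x' y') -> coheir x y -> coheir x' y'.
Proof.
move=> e xy P dP Px'y'.
have [t Pt] := xy P dP (hull_equiv_sym e dP Px'y').
have ey := hull_equiv_rename (f := @inr X Y) e.
exists t; apply: (ey (fun y => P (join (hull \o t) y))) Pt.
exact: hull_definable_inst.
Qed.

Variable kappa : Type.
Hypothesis kappa_nat : small kappa [set: nat].
Hypothesis satM : saturated M kappa.
Hypothesis smallC : small kappa C.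

Let params (G : Type) (g : G -> M) := (C `|` range hull) `|` range g.

Let small_params (G : countType) (g : G -> M) : small kappa (params g).
Proof.
apply: smallU => //; first by apply: smallU => //; exact: small_hull.
exact: small_range.
Qed.

Let hull_definable_params (X G : Type) (g : G -> M) (P : (X + G -> M) -> Prop) :
  hull_definable P -> definable_over (params g) (fun x => P (join x g)).
Proof.
move=> /hull_definable_over[Q dQ QP].
pose f (t : hull_term + (X + G)) : X + (G + hull_term) := match t with
  | inl t => inr (inr t) | inr (inl x) => inl x | inr (inr k) => inr (inl k) end.
have fE x : join x (join g hull) \o f = join hull (join x g).
  by apply/funext => -[|[]].
have sC : C `<=` params g by move=> x Cx; left; left.
have sg k : params g (join g hull k).
  by case: k => [k|t]; [right; exists k|left; right; exists t].
apply: class_iff (definable_over_inst sC sg (class_rename dcl f dQ)) => x.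
by rewrite fE QP.
Qed.

(* A failure would be witnessed by a formula over [b]; by coheirness it already
   occurs for parameters [g] in the hull, and then [r] can be found there. *)
Lemma coheir_extend_left (G Z B : finType) (g : G -> M) (b : B -> M) (r : Z -> M) :
  coheir g b -> exists r', hull_equiv (join g r) (join g r') /\ coheir (join g r') b.
Proof.
move=> gb.
(* [p.1] is a formula of [(g, r)] to be preserved, [p.2] a formula over [b] without solution in the
   hull, to be avoided. Avoiding all of these is being a coheir. *)
pose ok (p : ((G + Z -> M) -> Prop) * (((G + Z) + B -> M) -> Prop)) :=
  [/\ hull_definable p.1, p.1 (join g r), hull_definable p.2 &
  forall t : G + Z -> hull_term, ~ p.2 (join (hull \o t) b)].
have [|||||r' r'P] := @saturation _ _ _ kappa_nat satM Z (params (join g b)) _ ok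
  (fun p x => p.1 (join g x) /\ ~ p.2 (join (join g x) b)).
- exact: small_params.
- exists (fun=> True, fun=> False).
  by split=> //; [exact: (class_true hcl)|exact: (class_false hcl)|move=> t []].
- move=> [P Q] [P' Q'] [] /= dP Pg dQ nQ [] /= dP' P'g dQ' nQ'.
  exists (fun v => P v /\ P' v, fun v => Q v \/ Q' v).
    split=> /=; [exact: (class_and hcl)|by split|exact: (class_or hcl)|].
    by move=> t [/nQ|/nQ'].
  by move=> x [[Px P'x] /not_orP[]].
- move=> [P Q] [/= dP _ dQ _].
  pose f (k : G + Z) : Z + (G + B) := match k with inl k => inr (inl k) | inr z => inl z end.
  pose f' (k : (G + Z) + B) : Z + (G + B) :=
    match k with inl k => f k | inr k => inr (inr k) end.
  have := hull_definable_params (join g b)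
    (class_and hcl (class_rename hcl f dP) (class_not hcl (class_rename hcl f' dQ))).
  apply: class_iff => x.
  have -> : join x (join g b) \o f = join g x by apply/funext => -[].
  by have -> : join x (join g b) \o f' = join (join g x) b by apply/funext => -[[]|].
- move=> [P Q] [/= dP Pg dQ nQ]; apply: contrapT => nx.
  pose f (k : G + Z) : (G + B) + Z := match k with inl k => inl (inl k) | inr z => inr z end.
  pose f' (k : (G + Z) + B) : (G + B) + Z :=
    match k with inl k => f k | inr k => inl (inr k) end.
  have fE g' x : join (join g' b) x \o f = join g' x by apply/funext => -[].
  have fE' g' x : join (join g' b) x \o f' = join (join g' x) b.
    by apply/funext => -[[]|].
  have dPf := class_rename hcl f dP; have dQf := class_rename hcl f' dQ.
  have [||t [[x]]] := gb (fun w => (exists x : Z -> M, P (join w x \o f)) /\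
      ~ exists x : Z -> M, P (join w x \o f) /\ ~ Q (join w x \o f')).
  + apply: (class_and hcl); first exact: (class_ex hcl dPf).
    apply: (class_not hcl).
    exact: (class_ex hcl (class_and hcl dPf (class_not hcl dQf))).
  + split; first by exists r; rewrite fE.
    by move=> [x]; rewrite fE fE' => xP; apply: nx; exists x.
  rewrite fE => Px nPQ.
  have [|u Pu] := hull_elementary (hull_definable_inst t dP); first by exists x.
  apply: nPQ; exists (hull \o u); rewrite fE fE'; split=> // Qu.
  apply: (nQ (join t u)); move: Qu; congr (Q (join _ b)).
  by apply/funext => -[].
exists r'; split=> [P dP Pg|P dP Pr'].
  have okP : ok (P, fun=> False).
    by split=> //; [exact: (class_false hcl)|move=> t []].
  by have [] := r'P _ okP.
apply: contrapT => /forallNP nt.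
have okP : ok (fun=> True, P) by split=> //; exact: (class_true hcl).
by have [] := r'P _ okP.
Qed.

(** If no [R'] met a given finite part of the conditions, the formula saying so would hold of [g]
    and [e], hence of some [t] in the hull and [e]. But with [t] in place of [g] the array [R]
    itself meets them, as its columns have the type of [e] over the hull. *)
Lemma coheir_move (G E K : finType) (g : G -> M) (e : E -> M) (R : K * E -> M) :
  (forall j, hull_equiv e (fun y => R (j, y))) -> coheir g e ->
  exists R', [/\ hull_equiv R R', coheir g R' &
    forall j, hull_equiv (join g e) (join g (fun y => R' (j, y)))].
Proof.
move=> eR ge.
pose ok (p : ((K * E -> M) -> Prop) * ((G + K * E -> M) -> Prop) *
    ((G + E -> M) -> Prop)) := [/\ hull_definable p.1.1 /\ p.1.1 R, hull_definable p.1.2 /\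
  (forall t : G -> hull_term, ~ p.1.2 (join (hull \o t) R)) &
  hull_definable p.2 /\ p.2 (join g e)].
have [|||||R' R'P] := @saturation _ _ _ kappa_nat satM _ (params g) _ ok
  (fun p x => [/\ p.1.1 x, ~ p.1.2 (join g x) &
    forall j, p.2 (join g (fun y => x (j, y)))]).
- exact: small_params.
- exists (fun=> True, fun=> False, fun=> True).
  by split; split=> //; [exact: (class_true hcl)|exact: (class_false hcl)|move=> t []
    |exact: (class_true hcl)].
- move=> [[Q P] O] [[Q' P'] O'] [/= [dQ QR] [dP nP] [dO Og]].
  move=> [/= [dQ' QR'] [dP' nP'] [dO' Og']].
  exists (fun v => Q v /\ Q' v, fun v => P v \/ P' v, fun v => O v /\ O' v).
    split=> /=; split=> //; [exact: (class_and hcl)|exact: (class_or hcl)| |exact: (class_and hcl)].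
    by move=> t [/nP|/nP'].
  move=> x [[Qx Q'x] /not_orP[nPx nP'x] Ox].
  by split; split=> // j; have [] := Ox j.
- move=> [[Q P] O] [/= [dQ _] [dP _] [dO _]].
  pose f (k : G + K * E) : K * E + G := match k with inl k => inr k | inr k => inl k end.
  pose f' j (k : G + E) : K * E + G := match k with inl k => inr k | inr k => inl (j, k) end.
  have := hull_definable_params g (class_and hcl (class_rename hcl inl dQ)
    (class_and hcl (class_not hcl (class_rename hcl f dP))
      (class_bigand hcl (fun j => class_rename hcl (f' j) dO)))).
  apply: class_iff => x.
  have -> : join x g \o f = join g x by apply/funext => -[].
  have fE j : join x g \o f' j = join g (fun y => x (j, y)) by apply/funext => -[].
  split=> [[? [? H]]|[? ? H]]; first by split=> // j; rewrite -fE.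
  by split=> //; split=> // j; rewrite fE.
- move=> [[Q P] O] [/= [dQ QR] [dP nP] [dO Og]]; apply: contrapT => nx.
  pose f (k : G + K * E) : (G + E) + K * E :=
    match k with inl k => inl (inl k) | inr k => inr k end.
  pose f' j (k : G + E) : (G + E) + K * E :=
    match k with inl k => inl (inl k) | inr k => inr (j, k) end.
  have fE g' y x : join (join g' y) x \o f = join g' x by apply/funext => -[].
  have fE' j g' y x : join (join g' y) x \o f' j = join g' (fun k => x (j, k)).
    by apply/funext => -[].
  have [||t [Ot]] := ge (fun w => O w /\ ~ exists x : K * E -> M,
    [/\ Q x, ~ P (join w x \o f) & forall j, O (join w x \o f' j)]).
  + apply: (class_and hcl) => //; apply: (class_not hcl).
    have := class_ex hcl (class_and hcl (class_rename hcl inr dQ)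
      (class_and hcl (class_not hcl (class_rename hcl f dP))
      (class_bigand hcl (fun j => class_rename hcl (f' j) dO)))).
    by apply: class_iff => w; split=> [[x [? [? ?]]]|[x [? ? ?]]]; exists x.
  + split=> // -[x [Qx nPx Ox]]; apply: nx; exists x; split=> //.
      by move: nPx; rewrite fE.
    by move=> j; have := Ox j; rewrite fE'.
  apply; exists R; split=> [//||j]; first by rewrite fE.
  rewrite fE'; apply: (eR j (fun y => O (join (hull \o t) y))) => //.
  exact: hull_definable_inst.
have RR' : hull_equiv R R'.
  move=> Q dQ QR; have okQ : ok (Q, fun=> False, fun=> True).
    by split; split=> //; [exact: (class_false hcl)|move=> t []|exact: (class_true hcl)].
  by have [] := R'P _ okQ.
exists R'; split=> // [P dP PR'|j O dO Og].
  apply: contrapT => /forallNP nt; have okP : ok (fun=> True, P, fun=> True).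
    split; split=> //; try exact: (class_true hcl).
    move=> t Pt; apply: (nt t); apply: (RR' (fun x => P (join (hull \o t) x))) => //.
    exact: hull_definable_inst.
  by have [] := R'P _ okP.
have okO : ok (fun=> True, fun=> False, O).
  by split; split=> //; [exact: (class_true hcl)|exact: (class_false hcl)|move=> t []].
by have [_ _ /(_ j)] := R'P _ okO.
Qed.

(** [R] is kept in reserve: each new row realises the type of [R] over [g] and the earlier rows,
    chosen so that all rows so far remain a coheir over [R]. The earlier rows are then a coheir over
    the new one too. *)
Lemma coheir_rows (G Z : finType) (g : G -> M) (R : Z -> M) (N : nat) : coheir g R ->
  exists2 r : nat -> Z -> M,
    forall i, i < N -> hull_equiv (join g R) (join g (r i)) /\
      coheir (join g (fun p : 'I_i * Z => r p.1 p.2)) (r i) &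
    coheir (join g (fun p : 'I_N * Z => r p.1 p.2)) R.
Proof.
move=> gR; elim: N => [|N [r rP rR]].
  exists (fun=> R) => //.
  pose f (k : G + 'I_0 * Z) : G := match k with inl k => k | inr (Ordinal _ h, _) =>
    match notF h with end end.
  have := coheir_rename (f := f) (g := id) gR; congr (coheir _ _).
  by apply/funext => -[|[[]]].
have [r' [hr' rr']] := coheir_extend_left R rR.
set h := join g _ in rR hr' rr'.
pose r2 n := if n < N then r n else r'.
have r2N : r2 N = r' by rewrite /r2 ltnn.
have r2E i : i <= N -> (fun p : 'I_i * Z => r2 p.1 p.2) = (fun p => r p.1 p.2).
  by move=> iN; apply/funext => p; rewrite /r2 (leq_trans (ltn_ord _)).
exists r2 => [i|].
  rewrite ltnS leq_eqVlt => /orP[/eqP ->|iN]; last first.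
    by rewrite (r2E _ (ltnW iN)) /r2 iN; exact: rP.
  rewrite r2E// r2N; split; last exact: coheir_equiv hr' rR.
  pose f (k : G + Z) : (G + 'I_N * Z) + Z :=
    match k with inl k => inl (inl k) | inr k => inr k end.
  have fE y : join h y \o f = join g y by apply/funext => -[].
  by have := hull_equiv_rename (f := f) hr'; rewrite !fE.
pose f (k : G + 'I_N.+1 * Z) : (G + 'I_N * Z) + Z := match k with
  | inl k => inl (inl k)
  | inr (i, z) => if insub (val i) is Some j then inl (inr (j, z)) else inr z end.
have := coheir_rename (f := f) (g := id) rr'; congr (coheir _ _).
apply/funext => -[//|[i z]] /=; rewrite /f /r2 /=.
by case: insubP => [j -> /= <- //|/negbTE ->].
Qed.

End Hull.

(** * The broom lemma *)

Section Broom.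
Variables (L : language) (M : structure L) (kappa : Type) (C : set M) (m0 : M).
Variable At : nat -> (nat -> M) -> Prop.
Hypothesis defAt : forall i, definable_over C (At i).
Hypothesis kappa_nat : small kappa [set: nat].
Hypothesis satM : saturated M kappa.
Hypothesis smallC : small kappa C.

Notation hdef := (hull_definable m0 At).
Notation hequiv := (hull_equiv m0 At).
Notation hcoh := (coheir m0 At).
Let hcl := hull_definable_class m0 defAt.

Variables (X E : finType) (n : nat) (rho : (E -> M) -> Prop)
  (psi : 'I_n -> (X + E -> M) -> Prop) (e : E -> M).
Hypothesis hrho : hdef rho.
Hypothesis hpsi : forall l, hdef (psi l).
Hypothesis psi_bound : forall l, exists N, forall (T : finType) (c : T -> E -> M),
  N <= #|T| -> ~ shattered (psi l) c.
Hypothesis psi_divides : forall l, exists (k : nat) (b : nat -> E -> M),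
  (forall i, hequiv e (b i)) /\
  forall s : 'I_k -> nat, injective s -> ~ exists x : X -> M, forall i, psi l (join x (b (s i))).

(** Take [N] rows, each a conjugate of the first [K] terms of a dividing sequence. If all
    transversals were consistent, [shattered_transversal] would give one shattered by [psi l], of
    length beyond the bound for [psi l]. An inconsistent transversal inherits the coheir property of
    the rows. *)
Lemma inconsistent_coheir_sequence (l : 'I_n) (G : finType) (g : G -> M) (e0 : E -> M) :
  hequiv e e0 -> hcoh g e0 -> exists N (c : nat -> E -> M),
    (forall i, i < N -> hequiv (join g e0) (join g (c i)) /\
       hcoh (join g (fun p : 'I_i * E => c p.1 p.2)) (c i)) /\
    ~ exists x : X -> M, forall i, i < N -> psi l (join x (c i)).
Proof.
move=> ee0 ge0.
have [N Nbound] := psi_bound l; have [k [b [be bk]]] := psi_divides l.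
have [K HK] := shattered_transversal N k 1.
have e0b (j : 'I_K) : hequiv e0 (fun y => b (val j) y).
  by apply: hull_equiv_trans (be j); exact: (hull_equiv_sym defAt).
have [R [bR gR R0]] := coheir_move defAt kappa_nat satM smallC
  (R := fun p : 'I_K * E => b (val p.1) p.2) e0b ge0.
have [r rP _] := coheir_rows defAt kappa_nat satM smallC N gR.
pose inc (v : 'I_K * E -> M) := forall s : {ffun 'I_k -> 'I_K}, injective s ->
  ~ exists x : X -> M, forall i, psi l (join x (fun y => v (s i, y))).
have hinc : hdef inc.
  apply: (class_bigand hcl) => s; apply: (class_imp hcl); first exact: (class_const hcl).
  apply: (class_not hcl).
  pose f j (t : X + E) : 'I_K * E + X := match t with inl x => inr x | inr y => inl (j, y) end.
  have := class_ex hcl (class_bigand hcl (fun i => class_rename hcl (f (s i)) (hpsi l))).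
  have fE v x j : join v x \o f j = join x (fun y => v (j, y)) by apply/funext => -[].
  apply: class_iff => v.
  by split=> -[x xP]; exists x => i; have := xP i; rewrite fE.
have Rr i : i < N -> hequiv R (r i).
  by move=> /rP[/(hull_equiv_rename defAt (f := inr))].
have incr i : i < N -> inc (r i).
  move=> /Rr rR; apply: (rR inc hinc); apply: (bR inc hinc) => s sinj [x xP].
  apply: (bk (fun i => val (s i))); first by move=> j j' /val_inj/sinj.
  by exists x.
have e0r i (j : 'I_K) : i < N -> hequiv (join g e0) (join g (fun y => r i (j, y))).
  move=> /rP[h _]; apply: hull_equiv_trans (R0 j) _.
  pose f (t : G + E) : G + 'I_K * E := match t with inl x => inl x | inr y => inr (j, y) end.
  have fE (v : 'I_K * E -> M) : join g v \o f = join g (fun y => v (j, y)).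
    by apply/funext => -[].
  by have := hull_equiv_rename defAt (f := f) h; rewrite !fE.
pose col (i : nat) (j : nat) (y : E) : M := if insub j is Some j' then r i (j' : 'I_K, y) else m0.
have colE i j (jK : j < K) : col i j = fun y => r i (Ordinal jK, y).
  by apply/funext => y; rewrite /col insubT.
apply: contrapT => nc.
pose P (i j : nat) (x : X -> M) := j < K /\ psi l (join x (col i j)).
have [||a aK aP] := HK unit (card_unit) (X -> M) (fun _ _ => True) P.
- move=> i x s iN sinj; apply: contrapT => /forallNP H.
  have {}H j : P i (s j) x by apply: contrapT; exact: H.
  have sK j : s j < K by have [] := H j.
  apply: (incr i iN [ffun j => Ordinal (sK j)]).
    by move=> j j'; rewrite !ffunE => -[/sinj].
  exists x => j; rewrite ffunE; by have [_] := H j; rewrite (colE _ _ (sK j)).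
- move=> _ eta etaK; apply: contrapT => nx; apply: nc.
  exists N, (fun i => col i (eta i)); split=> [i iN|[x xP]]; last first.
    by apply: nx; exists x; split=> // i iN; split=> //; exact: xP.
  rewrite (colE _ _ (etaK i)); split; first exact: e0r.
  have [_ cohi] := rP i iN.
  pose f (t : G + 'I_i * E) : G + 'I_i * ('I_K * E) := match t with
    | inl x => inl x | inr (i', y) => inr (i', (Ordinal (etaK i'), y)) end.
  have := coheir_rename defAt (f := f) (g := fun y : E => (Ordinal (etaK i), y)) cohi.
  congr (coheir m0 At _ _); apply/funext => -[//|[i' y]] /=.
  by rewrite (colE _ _ (etaK i')).
apply: (@Nbound 'I_N (fun i => col i (a i))); first by rewrite card_ord.
move=> S; have [x [_ xP]] := aP tt (fun i => if insub i is Some j then S j else False).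
exists x => i; have := xP i (ltn_ord i); rewrite /P (valK i) => <-.
by split=> [|[]].
Qed.

(** [Phi] follows from finitely many instances of the disjunction of the [psi l], at tuples of which
    only [rho] is remembered. For [Phi] false this is quasi-dividing of the disjunction. *)
Definition entailed (Phi : (X -> M) -> Prop) : Prop :=
  exists (F : finType) (c : F -> E -> M), (forall i, rho (c i)) /\
    forall x, (forall i, exists l, psi l (join x (c i))) -> Phi x.

Lemma entailed_and (T : finType) (Phi : T -> (X -> M) -> Prop) :
  (forall t, entailed (Phi t)) -> entailed (fun x => forall t, Phi t x).
Proof.
move=> ent.
have /choice[p pP] : forall t, exists p : {F : finType & F -> E -> M},
    (forall i, rho (tagged p i)) /\
    forall x, (forall i, exists l, psi l (join x (tagged p i))) -> Phi t x.
  by move=> t; have [F [c cP]] := ent t; exists (Tagged (fun F : finType => F -> E -> M) c).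
exists {t : T & tag (p t)}, (fun q => tagged (p (tag q)) (tagged q)).
split=> [q|x xP t]; first by have [] := pP (tag q).
have [_] := pP t; apply=> i; exact: xP (Tagged (fun t => tag (p t)) i).
Qed.

Lemma entailed_weaken (Phi Psi : (X -> M) -> Prop) :
  (forall x, Phi x -> Psi x) -> entailed Phi -> entailed Psi.
Proof. by move=> PP [F [c [cr cP]]]; exists F, c; split=> // x /cP/PP. Qed.

(** For a fixed finite [F], being entailed is a formula about the parameters. The instances may
    change along with them, which is why they are only required to satisfy [rho]. *)
Lemma entailed_equiv (G : finType) (v w : G -> M) (Phi : (X + G -> M) -> Prop) :
  hdef Phi -> hequiv v w -> entailed (fun x => Phi (join x v)) ->
  entailed (fun x => Phi (join x w)).
Proof.
move=> hPhi vw [F [c [cr cP]]].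
pose Q (y : F * E -> M) (u : G -> M) := (forall i, rho (fun t => y (i, t))) /\
  forall x : X -> M, (forall i, exists l, psi l (join x (fun t => y (i, t)))) -> Phi (join x u).
have hQ : hdef (fun u : G -> M => exists y, Q y u).
  have hQ' : hdef (fun p : G + F * E -> M => Q (p \o inr) (p \o inl)).
    apply: (class_and hcl).
      by apply: (class_bigand hcl) => i; exact: (class_rename hcl (fun t => inr (i, t))).
    pose f i (t : X + E) : (G + F * E) + X :=
      match t with inl x => inr x | inr y => inl (inr (i, y)) end.
    pose f' (t : X + G) : (G + F * E) + X :=
      match t with inl x => inr x | inr y => inl (inl y) end.
    have := class_all hcl (class_imp hcl (class_bigand hcl (fun i => class_bigor hcl
      (fun l => class_rename hcl (f i) (hpsi l)))) (class_rename hcl f' hPhi)).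
    have fE p x i : join p x \o f i = join x (fun t => (p \o inr) (i, t)).
      by apply/funext => -[].
    have fE' p x : join p x \o f' = join x (p \o inl) by apply/funext => -[].
    apply: class_iff => p; split=> H x xP; have := H x; rewrite fE'; apply=> i;
    by have [l] := xP i; exists l; rewrite ?fE//; rewrite -fE.
  exact: class_ex hQ'.
have [y [yr yP]] : exists y, Q y w.
  by apply: (vw _ hQ); exists (fun p => c p.1 p.2).
by exists F, (fun i t => y (i, t)).
Qed.

(* The broom: [psi l] at [e0] is removed from the disjunction by moving [e0]
   along an inconsistent sequence. This multiplies the remaining disjuncts,
   but [g] and the copies preceding a given copy are still a coheir over it,
   so the copies can be removed in turn, last one first. *)
Lemma broom (s : seq 'I_n) (G : finType) (g : G -> M) (e0 : E -> M)
    (Th : (X + G -> M) -> Prop) :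
  hdef Th -> hequiv e e0 -> hcoh g e0 ->
  entailed (fun x => (exists2 l, l \in s & psi l (join x e0)) \/ Th (join x g)) ->
  entailed (fun x => Th (join x g)).
Proof.
elim: s G g e0 Th => [|l s IH] G g e0 Th hTh ee0 ge0 ent.
  by apply: entailed_weaken ent => x [[l]|].
have [N [c [cP cN]]] := inconsistent_coheir_sequence l ee0 ge0.
have hs (V : Type) (f : X + E -> V) :
    hdef (fun v => exists2 l', l' \in s & psi l' (v \o f)).
  have := class_bigor hcl (fun l' : {l' | l' \in s} =>
    class_rename hcl f (hpsi (val l'))).
  apply: class_iff => v; split=> [[[l' l's] pv]|[l' l's pv]]; first by exists l'.
  by exists (exist _ l' l's).
(* The hypothesis is moved to every [c i] and the results are conjoined. Since [psi l] cannot hold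
   at all the [c i], at some [i] a disjunct from [s] takes over. *)
have entN : entailed (fun x => (exists i : 'I_N, exists2 l', l' \in s & psi l' (join x (c i)))
    \/ Th (join x g)).
  pose f (t : X + E) : X + (G + E) := match t with inl x => inl x | inr y => inr (inr y) end.
  pose f' (t : X + G) : X + (G + E) := match t with inl x => inl x | inr y => inr (inl y) end.
  pose Phi v := (psi l (v \o f) \/ exists2 l', l' \in s & psi l' (v \o f)) \/ Th (v \o f').
  have fE x g' y : join x (join g' y) \o f = join x y by apply/funext => -[].
  have fE' x g' (y : E -> M) : join x (join g' y) \o f' = join x g' by apply/funext => -[].
  have hPhi : hdef Phi.
    apply: (class_or hcl); last exact: (class_rename hcl).
    by apply: (class_or hcl); [exact: (class_rename hcl)|exact: hs].
  have : entailed (fun x => forall i : 'I_N, Phi (join x (join g (c i)))).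
    apply: entailed_and => i; have [gei _] := cP i (ltn_ord i).
    apply: (entailed_equiv hPhi gei); apply: entailed_weaken ent => x.
    rewrite /Phi fE fE' => -[[l']|]; last by right.
    by rewrite inE => /orP[/eqP -> ?|l's ?]; left; [left|right; exists l'].
  apply: entailed_weaken => x xP; apply: contrapT => /not_orP[nex nTh].
  apply: cN; exists x => i iN; have := xP (Ordinal iN).
  rewrite /Phi fE fE' => -[[//|H]|//]; by case: nex; exists (Ordinal iN).
have down i : i <= N -> entailed (fun x =>
    (exists i' : 'I_i, exists2 l', l' \in s & psi l' (join x (c i'))) \/ Th (join x g)) ->
    entailed (fun x => Th (join x g)).
  elim: i => [|i IHi] iN enti.
    by apply: entailed_weaken enti => x [[[]]|].
  apply: IHi; first exact: ltnW.
  have [gei ci] := cP i iN.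
  pose g' := join g (fun p : 'I_i * E => c p.1 p.2).
  pose f (i' : 'I_i) (t : X + E) : X + (G + 'I_i * E) :=
    match t with inl x => inl x | inr y => inr (inr (i', y)) end.
  pose f' (t : X + G) : X + (G + 'I_i * E) :=
    match t with inl x => inl x | inr y => inr (inl y) end.
  have fE x i' : join x g' \o f i' = join x (c i') by apply/funext => -[].
  have fE' x : join x g' \o f' = join x g by apply/funext => -[].
  pose Th' v := (exists i' : 'I_i, exists2 l', l' \in s & psi l' (v \o f i')) \/ Th (v \o f').
  have hTh' : hdef Th'.
    apply: (class_or hcl); last exact: (class_rename hcl).
    by apply: (class_bigor hcl) => i'; exact: hs.
  have := IH _ g' (c i) Th' hTh' _ ci.
  have Th'E x : Th' (join x g') <->
      (exists i' : 'I_i, exists2 l', l' \in s & psi l' (join x (c i'))) \/ Th (join x g).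
    rewrite /Th' fE'; split=> -[[i' [l' l's pl']]|]; [left|by right|left|by right];
    by exists i', l' => //; rewrite ?fE// -fE.
  move=> H; apply: (entailed_weaken (fun x => (Th'E x).1)); apply: H.
    apply: hull_equiv_trans ee0 _.
    exact: (hull_equiv_rename defAt (f := @inr G E) gei).
  apply: entailed_weaken enti => x [[i' [l' l's pl']]|th]; last first.
    by right; apply/Th'E; right.
  have [ii'|ii'] := eqVneq (val i') i.
    by left; exists l' => //; rewrite -ii'.
  have i'i : i' < i by rewrite ltn_neqAle ii' -ltnS ltn_ord.
  by right; apply/Th'E; left; exists (Ordinal i'i), l'.
exact: down N (leqnn N) entN.
Qed.

Lemma disjunction_quasi_divides : rho e -> entailed (fun _ => False).
Proof.
move=> re; apply: (@broom (enum 'I_n) void (of_void M) e (fun _ => False)).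
- exact: (class_false hcl).
- by [].
- move=> P hP Pe; exists (of_void _); move: Pe; congr (P (join _ _)).
  by apply/funext => -[].
exists unit, (fun=> e); split=> // x /(_ tt)[l pl]; left; exists l => //.
by rewrite mem_enum.
Qed.

End Broom.

(** * Forking and dividing *)

Section ForkingDividing.
Variables (L : language) (M : structure L) (kappa : Type) (C : set M).
Hypothesis kappa_nat : small kappa [set: nat].
Hypothesis satM : saturated M kappa.
Hypothesis smallC : small kappa C.
Hypothesis NIP : forall n m (phi : formula L ('I_n + 'I_m)), ~ has_IP M phi.
Hypothesis baseC : extension_base C.

Notation defC := (definable_over C).
Let dcl := definable_over_class C.

Lemma quasi_divides (X E : finType) (n : nat) (psi : 'I_n -> (X + E -> M) -> Prop)
    (rho : (E -> M) -> Prop) (e : E -> M) :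
  (forall l, defC (psi l)) -> (forall l, divides_pred C (psi l) e) ->
  defC rho -> rho e ->
  exists (F : finType) (c : F -> E -> M), (forall i, rho (c i)) /\
    ~ exists x, forall i, exists l, psi l (join x (c i)).
Proof.
move=> dpsi psie drho re; have [m0] := carrier_inhabited M.
(* Atom 0 is [rho], atom [l + 1] is [psi l]; the atoms beyond [n] are false. *)
pose At i (v : nat -> M) := if i is l.+1
  then (if insub l is Some l' then psi l' (v \o choice.pickle) else False)
  else rho (v \o (fun y : E => choice.pickle (inr y : X + E))).
have defAt i : defC (At i).
  case: i => [|l]; rewrite /At; first exact: (class_rename dcl).
  by case: (insub l : option 'I_n) => [l'|];
    [exact: (class_rename dcl choice.pickle (dpsi l'))|exact: (class_false dcl)].
(* With the hull independent from [e'], the dividing sequences of the [psi l] can be chosen in the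
   type of [e'] over the hull, as the broom requires. *)
have [e' ee' he'] := extend_independently kappa_nat satM smallC baseC e
  (small_hull (m0 := m0) (At := At) kappa_nat).
pose t0 : hull_term := GenTree.Leaf 0.
have [|||||F [c [cr cF]]] := @disjunction_quasi_divides _ _ _ _ m0 _ defAt kappa_nat
    satM smallC X E n rho psi e'.
- exists (CAt 0), (fun k => match choice.unpickle k : option (X + E) with
    | Some (inr y) => inl y | _ => inr t0 end) => y /=.
  by split; congr rho; apply/funext => k /=; rewrite choice.pickleK.
- move=> l; exists (CAt l.+1), (fun k => match choice.unpickle k : option (X + E) with
    | Some t => inl t | _ => inr t0 end) => v /=.
  by rewrite /At (valK l); split; congr (psi l); apply/funext => k /=; rewrite choice.pickleK.
- by move=> l; exact: (not_shattered_bound kappa_nat satM smallC NIP (dpsi l)).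
- move=> l; have [k [b [be bk]]] := dividing_sequence_over kappa_nat satM smallC
    (small_hull (m0 := m0) (At := At) kappa_nat) (dpsi l) he' (divides_pred_equiv ee' (psie l)).
  exists k, b; split=> // i P /(hull_definable_over defAt)[Q dQ QP].
  by rewrite !QP; exact: be.
- exact: ee'.
exists F, c; split=> // -[x xP]; exact: cF x xP.
Qed.

(** Quasi-dividing gives finitely many tuples satisfying [P] at which the disjunctions of the
    formulas in [l] are jointly inconsistent. These tuples are moved together so as to avoid the
    formulas in [k] over [z]. As [z] cannot satisfy the disjunction at each of them, one of them
    avoids [l] as well. *)
Lemma extend_strictly_independently (Z E : finType) (z : Z -> M) (e : E -> M) :
  exists e', [/\ equiv_over C e e', indep_div C z e' & indep_div C e' z].
Proof.
pose ok (p : ((E -> M) -> Prop) * seq {classic (Z + E -> M) -> Prop} *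
    seq {classic (E + Z -> M) -> Prop}) :=
  [/\ defC p.1.1 /\ p.1.1 e,
      forall th, th \in p.1.2 -> defC th /\ divides_pred C th e &
      forall th, th \in p.2 -> defC th /\ divides_pred C th z].
have small_z : small kappa (range z).
  exact: small_range.
have [|||||e' e'P] := @saturation _ _ _ kappa_nat satM _ (C `|` range z) _ ok
  (fun p y => [/\ p.1.1 y, forall th, th \in p.1.2 -> ~ th (join z y) &
    forall th, th \in p.2 -> ~ th (join y z)]).
- exact: smallU.
- by exists (fun=> True, [::], [::]); split=> //; split=> //; exact: (class_true dcl).
- move=> [[P l] k] [[P' l'] k'] [/= [dP Pe] lP kP] [/= [dP' P'e] l'P k'P].
  exists (fun v => P v /\ P' v, l ++ l', k ++ k').
    split=> /=; first by split; [exact: (class_and dcl)|].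
      by move=> th; rewrite mem_cat => /orP[/lP|/l'P].
    by move=> th; rewrite mem_cat => /orP[/kP|/k'P].
  by move=> y [[Py P'y] ly ky]; split; split=> // th h; (apply: ly || apply: ky);
    rewrite mem_cat h ?orbT.
- move=> [[P l] k] [/= [dP _] lP kP]; have dA := definable_over_class (C `|` range z).
  have sub : C `<=` C `|` range z by move=> x; left.
  have subz i : (C `|` range z) (z i) by right; exists i.
  pose g (t : Z + E) : E + Z := match t with inl x => inr x | inr y => inl y end.
  have gE y : join y z \o g = join z y by apply/funext => -[].
  have dl : definable_over (C `|` range z) (fun y => forall th, th \in l -> ~ th (join z y)).
    apply: (class_bigand_seq dA) => th /lP[dth _]; apply: (class_not dA).
    by apply: class_iff (definable_over_inst sub subz (class_rename dcl g dth)) => y;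
      rewrite gE.
  have dk : definable_over (C `|` range z) (fun y => forall th, th \in k -> ~ th (join y z)).
    apply: (class_bigand_seq dA) => th /kP[dth _]; apply: (class_not dA).
    exact: (definable_over_inst sub subz dth).
  have := class_and dA (definable_overS sub dP) (class_and dA dl dk).
  by apply: class_iff => y; split=> [[? []]|[]].
- move=> [[P l] k] [/= [dP Pe] lP kP].
  pose psi (i : 'I_(size l)) := tnth (in_tuple l) i.
  have psil i : psi i \in l by exact: mem_tnth.
  have [F [c [cP cF]]] := quasi_divides (fun i => (lP _ (psil i)).1)
    (fun i => (lP _ (psil i)).2) dP Pe.
  pose f (i : F) (t : E + Z) : F * E + Z := sum_map (pair i) id t.
  pose lift (i : F) (th : {classic (E + Z -> M) -> Prop}) :
    {classic (F * E + Z -> M) -> Prop} := fun v => th (v \o f i).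
  pose k' := [seq lift i th | i <- enum F, th <- k].
  pose Q (v : F * E -> M) := (forall i, P (fun y => v (i, y))) /\
    ~ exists x, forall i, exists j, psi j (join x (fun y => v (i, y))).
  have dQ : defC Q.
    apply: (class_and dcl).
      by apply: (class_bigand dcl) => i; exact: (class_rename dcl (pair i)).
    apply: (class_not dcl).
    pose h i (t : Z + E) : F * E + Z := match t with inl x => inr x | inr y => inl (i, y) end.
    have := class_ex dcl (class_bigand dcl (fun i => class_bigor dcl (fun j =>
      class_rename dcl (h i) (lP _ (psil j)).1))).
    have hE v x i : join v x \o h i = join x (fun y => v (i, y)) by apply/funext => -[].
    apply: class_iff => v; split=> -[x xP]; exists x => i; have [j] := xP i;
    by exists j; rewrite ?hE// -hE.
  have [||v [vP vF] vk] := avoid_dividing (x0 := fun p => c p.1 p.2) (z := z) (l := k')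
    baseC _ dQ.
  + move=> th /allpairsP[[i th'] [_ /= /kP[dth' divth'] ->]]; split.
      exact: (class_rename dcl).
    exact: divides_pred_weaken.
  + by split.
  have /existsNP[i ni] : ~ forall i, exists j, psi j (join z (fun y => v (i, y))).
    by move=> H; apply: vF; exists z.
  exists (fun y => v (i, y)); split=> //.
    move=> th thl pth; apply: ni.
    have [j ej] := elimT (@tnthP _ _ (in_tuple l) th) thl.
    by exists j; rewrite /psi -ej.
  move=> th thk pth; apply: (vk (lift i th)).
    by apply/allpairsP; exists (i, th); rewrite mem_enum.
  by rewrite /lift /f join_sum_map.
have ee' : equiv_over C e e'.
  move=> P dP Pe; have okP : ok (P, [::], [::]) by split.
  by have [] := e'P _ okP.
exists e'; split=> // th dth the' divth.
  have okth : ok (fun=> True, [:: th : {classic _}], [::]).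
    split=> //=; first by split=> //; exact: (class_true dcl).
    move=> th'; rewrite inE => /eqP ->; split=> //.
    by apply: divides_pred_equiv divth; exact: equiv_over_sym.
  by have [_ /(_ th)] := e'P _ okth; rewrite mem_head => /(_ isT).
have okth : ok (fun=> True, [::], [:: th : {classic _}]).
  split=> //=; first by split=> //; exact: (class_true dcl).
  by move=> th'; rewrite inE => /eqP ->.
by have [_ _ /(_ th)] := e'P _ okth; rewrite mem_head => /(_ isT).
Qed.

Lemma strictly_independent_sequence (E : finType) (e : E -> M) :
  exists c : nat -> E -> M, forall i, [/\ equiv_over C e (c i),
    indep_div C (fun p : 'I_i * E => c p.1 p.2) (c i) &
    indep_div C (c i) (fun p : 'I_i * E => c p.1 p.2)].
Proof.
have /choice[g gP] : forall p : nat * (nat -> E -> M), exists e',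
    [/\ equiv_over C e e', indep_div C (fun q : 'I_p.1 * E => p.2 q.1 q.2) e' &
    indep_div C e' (fun q : 'I_p.1 * E => p.2 q.1 q.2)].
  by move=> p; exact: extend_strictly_independently.
pose hist := fix hist n := if n is n'.+1
  then fun i => if i == n' then g (n', hist n') else hist n' i else fun=> e.
pose c i := g (i, hist i).
have histE n i : i < n -> hist n i = c i.
  elim: n => // n IH; rewrite ltnS leq_eqVlt => /orP[/eqP ->|h] /=; first by rewrite eqxx.
  by rewrite ltn_eqF// IH.
exists c => i; have := gP (i, hist i) => /=.
suff -> : (fun q : 'I_i * E => hist i q.1 q.2) = (fun q => c q.1 q.2) by [].
by apply/funext => -[j y] /=; rewrite histE.
Qed.

Lemma indep_div_empty (X Y : Type) (x : X -> M) (y : Y -> M) :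
  (X -> False) -> indep_div C x y.
Proof.
move=> X0 psi dpsi psixy [k [b [be bk]]].
pose f (t : X + Y) : Y := match t with inl x => match X0 x with end | inr y => y end.
have fE y' : y' \o f = join x y' by apply/funext => -[x'|//]; case: (X0 x').
apply: (bk (@nat_of_ord k)); first exact: ord_inj.
exists x => i; rewrite -fE; apply: (be i _ (class_rename dcl f dpsi)).
by rewrite fE.
Qed.

(** By transitivity the terms after [i] are together independent from those up to [i] ([post]), and
    a further use adds the terms before [i]. This is why both directions of independence are needed
    in the sequence. *)
Lemma strictly_independent_others (E : finType) (c : nat -> E -> M) :
  (forall i, indep_div C (fun p : 'I_i * E => c p.1 p.2) (c i)) ->
  (forall i, indep_div C (c i) (fun p : 'I_i * E => c p.1 p.2)) ->
  forall (T : finType) (u : T -> nat), injective u ->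
  forall t, indep_div C (other_terms (c \o u) t) (c (u t)).
Proof.
move=> cpre prec T u uinj t; set i := u t.
have small_fin (Z : finType) (z : Z -> M) : small kappa (range z).
  exact: small_range.
have post m : indep_div C (fun p : 'I_m * E => c (i.+1 + p.1) p.2)
    (fun p : 'I_i.+1 * E => c p.1 p.2).
  elim: m => [|m IH]; first by apply: indep_div_empty => -[[]].
  pose f (p : 'I_m * E + 'I_i.+1 * E) : 'I_(i.+1 + m) * E := match p with
    | inl (j, y) => (rshift i.+1 j, y) | inr (j, y) => (lshift m j, y) end.
  pose f' (p : 'I_(i.+1 + m) * E) : 'I_m * E + 'I_i.+1 * E :=
    match fintype.split p.1 with inl j => inr (j, p.2) | inr j => inl (j, p.2) end.
  have splitl j : fintype.split (lshift m j) = inl j := unsplitK (inl j).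
  have splitr j : fintype.split (rshift i.+1 j) = inr j := unsplitK (inr j).
  have fK : cancel f f'.
    by move=> [[j y]|[j y]]; rewrite /f' /= ?splitl ?splitr.
  have f'K : cancel f' f.
    by move=> [j y]; rewrite /f' /=; case: (split_ordP j) => j' -> /=.
  have e1 : join (fun p : 'I_m * E => c (i.+1 + p.1) p.2)
      (fun p : 'I_i.+1 * E => c p.1 p.2) = (fun p : 'I_(i.+1 + m) * E => c p.1 p.2) \o f.
    by apply/funext => -[[j y]|[j y]].
  have H := indep_div_trans kappa_nat satM smallC (small_fin _ _) IH
    (indep_div_eqR fK f'K e1 (prec (i.+1 + m))).
  pose h (p : 'I_m.+1 * E) : 'I_m * E + E :=
    if insub (val p.1) is Some j then inl (j, p.2) else inr p.2.
  have := indep_div_renameL (f := h) H; congr (indep_div C _ _).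
  apply/funext => -[j y]; rewrite /h /=; case: insubP => [j' _ /= <- //|].
  rewrite -leqNgt => mj; suff -> : nat_of_ord j = m by [].
  by apply/eqP; rewrite eqn_leq mj -ltnS ltn_ord.
pose N := \max_s u s.
pose f (p : 'I_i * E + E) : 'I_i.+1 * E := match p with
  | inl (j, y) => (widen_ord (leqnSn i) j, y) | inr y => (ord_max, y) end.
pose f' (p : 'I_i.+1 * E) : 'I_i * E + E :=
  if insub (val p.1) is Some j then inl (j, p.2) else inr p.2.
have fK : cancel f f'.
  move=> [[j y]|y]; rewrite /f' /=; first by rewrite (valK j).
  by rewrite insubF ?ltnn.
have f'K : cancel f' f.
  move=> [j y]; rewrite /f' /=; case: insubP => [j' _ /= jj'|].
    by congr pair; exact: val_inj.
  rewrite -leqNgt => ij; congr pair; apply: val_inj => /=.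
  by apply/eqP; rewrite eqn_leq ij -ltnS ltn_ord.
have e1 : join (fun p : 'I_i * E => c p.1 p.2) (c i) = (fun p : 'I_i.+1 * E => c p.1 p.2) \o f.
  by apply/funext => -[[j y]|y].
have H := indep_div_trans kappa_nat satM smallC (small_fin _ _) (cpre i)
  (indep_div_eqR fK f'K e1 (post N.+1)).
pose h (p : {s | s != t} * E) : 'I_i * E + 'I_N.+1 * E :=
  if insub (u (val p.1)) is Some j then inl (j, p.2)
  else inr (inord (u (val p.1) - i.+1), p.2).
have := indep_div_renameL (f := h) H; congr (indep_div C _ _).
apply/funext => -[[s st] y]; rewrite /h /other_terms /=.
case: insubP => [j _ /= -> //|/=]; rewrite -leqNgt => is_.
have lt_is : i < u s by rewrite ltn_neqAle is_ andbT; apply: contra st => /eqP/uinj ->.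
rewrite inordK ?subnKC// ltnS (leq_trans (leq_subr _ _))//.
exact: (leq_bigmax s).
Qed.

Lemma divides_disjunction (X E : finType) (n : nat) (psi : 'I_n -> (X + E -> M) -> Prop)
    (chi : (X + E -> M) -> Prop) (e : E -> M) :
  (forall l, defC (psi l)) -> (forall l, divides_pred C (psi l) e) -> defC chi ->
  (forall x, chi (join x e) -> exists l, psi l (join x e)) -> divides_pred C chi e.
Proof.
move=> dpsi psie dchi chipsi.
have [c cP] := strictly_independent_sequence e.
have /choice[N NP] : forall l, exists N, forall (T : finType) (c : T -> E -> M),
    N <= #|T| -> ~ shattered (psi l) c.
  by move=> l; exact: (not_shattered_bound kappa_nat satM smallC NIP (dpsi l)).
pose N' := \max_l N l.
(* Among [n * N' + 1] terms satisfying [chi] with one [x], at least [N'] satisfy the same disjunct;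
   [N'] bounds the length of the sequences shattered by any of the [psi l]. *)
exists (n * N').+1, c; split=> [i|s sinj [x xP]]; first by have [] := cP i.
have /choice[col colP] : forall i, exists l, psi l (join x (c (s i))).
  move=> i; have [eci _ _] := cP (s i).
  pose f (t : X + E) : E + X := match t with inl x => inr x | inr y => inl y end.
  have fE y x' : join y x' \o f = join x' y by apply/funext => -[].
  have dimp := class_all dcl (class_imp dcl (class_rename dcl f dchi)
    (class_bigor dcl (fun l => class_rename dcl f (dpsi l)))).
  have impe x' : chi (join e x' \o f) -> exists l, psi l (join e x' \o f).
    by rewrite fE => /chipsi.
  have [|l] := eci _ dimp impe x; first by rewrite fE; exact: xP.
  by rewrite fE; exists l.
have [l lN] : exists l, N' <= #|[set i | col i == l]%SET|.
  apply: contrapT => /forallNP H.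
  have : \sum_l #|[set i | col i == l]%SET| = (n * N').+1.
    rewrite -[RHS]card_ord -sum1_card (partition_big col predT)//=.
    by apply: eq_bigr => l _; rewrite -sum1_card; apply: eq_bigl => i; rewrite inE.
  apply/eqP; rewrite ltn_eqF// ltnS.
  apply: leq_trans (_ : \sum_(l < n) N' <= _); last by rewrite sum_nat_const card_ord.
  by apply: leq_sum => l _; apply: ltnW; rewrite ltnNge; apply/negP; exact: H.
pose T := {i | col i == l}.
apply: (NP l T (fun i => c (s (val i)))).
  apply: (leq_trans (leq_bigmax l)); rewrite card_sig; move: lN; rewrite -/N'.
  by congr (_ <= _); apply: eq_card => i; rewrite !inE.
apply: (independent_terms_shattered (dpsi l)).
- by move=> i; have [eci _ _] := cP (s (val i)); exact: divides_pred_equiv (psie l).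
- move=> i; apply: (@strictly_independent_others E c _ _ T (fun i => s (val i)) _ i).
  + by move=> j; have [] := cP j.
  + by move=> j; have [] := cP j.
  + by move=> j j' /sinj/val_inj.
- by exists x => -[i ci] /=; have := colP i; rewrite (eqP ci).
Qed.

End ForkingDividing.

(** * Homogeneity and indiscernibility *)

Section Automorphisms.
Variables (L : language) (M : structure L).

Lemma automorphism_sat (sigma : M -> M) (V : Type) (v : V -> M) (phi : formula L V) :
  automorphism sigma -> sat (sigma \o v) phi <-> sat v phi.
Proof.
move=> [[tau sK tK] sfunc srel].
have se W (w : W -> M) t : eval (sigma \o w) t = sigma (eval w t).
  elim: t => //= g args IH; rewrite sfunc; congr func_interp.
  by apply/funext => i /=; rewrite IH.
elim: phi v => {V} [V|V t u|V r args|V p IHp q IHq|V p IHp] v //=.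
- by rewrite !se; split=> [/(can_inj sK)|->].
- have -> : (fun i => eval (sigma \o v) (args i)) = sigma \o (fun i => eval v (args i)).
    by apply/funext => i /=; exact: se.
  by rewrite -srel.
- by rewrite IHp IHq.
- have e m : oapp (sigma \o v) (sigma m) = sigma \o oapp v m by apply/funext => -[].
  split=> H m; first by rewrite -IHp -e; exact: H.
  by rewrite -(tK m) e IHp.
Qed.

Variable kappa : Type.
Hypothesis kappa_nat : small kappa [set: nat].
Hypothesis homM : strongly_homogeneous M kappa.

Lemma definable_over_eq (A : set M) (X : Type) (k k' : X) :
  definable_over A (fun x : X -> M => x k = x k').
Proof. by exists (FEq (Var (inl k)) (Var (inl k'))). Qed.

Lemma definable_over_eq_param (A : set M) (X : Type) (k : X) (c : A) :
  definable_over A (fun x : X -> M => x k = val c).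
Proof. by exists (FEq (Var (inl k)) (Var (inr c))). Qed.

(** Saturation yields only countable tuples [w]; an automorphism fixing [B] and taking [x \o h] to
    [w] brings the rest of [x] along, whatever its length. *)
Lemma move_tuple (B : set M) (X : Type) (Z : countType) (x : X -> M) (h : Z -> X)
    (w : Z -> M) : small kappa B -> equiv_over B (x \o h) w ->
  exists2 y, equiv_over B x y & y \o h = w.
Proof.
move=> sB xhw; pose A := B `|` range (x \o h).
(* An element of [B] is named by itself even if it also occurs in the tuple, so that the map to be
   extended fixes [B]. *)
have /choice[r rP] : forall c : A, exists t : Z + B, join (x \o h) (fun b : B => val b) t = val c /\
    (B (val c) -> exists b, t = inr b).
  move=> c; have [Bc|nBc] := pselect (B (val c)).
    by exists (inr (in_sub Bc)); split=> // _; exists (in_sub Bc).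
  by case: (set_mem (valP c)) => // -[k _ xk]; exists (inl k); split.
pose f (c : A) := join w (fun b : B => val b) (r c).
have fe : elementary_map f.
  move=> phi; have e1 : (fun c : A => val c) = join (x \o h) (fun b : B => val b) \o r.
    by apply/funext => c /=; have [] := rP c.
  have e2 : f = join w (fun b : B => val b) \o r by [].
  rewrite e1 e2 -!sat_rename.
  have /equiv_overP e := xhw; have : tp B (x \o h) (rename phi r) = tp B w (rename phi r).
    by rewrite e.
  by rewrite /tp /= /holds => ->.
have sA : small kappa A.
  apply: smallU => //; exact: small_range.
have [sigma aut sE] := homM sA fe.
have sB' b : B b -> sigma b = b.
  move=> Bb; have Ab : A b by left.
  have := sE (in_sub Ab); rewrite /f; have [+ /(_ Bb)[b' rb]] := rP (in_sub Ab).
  by rewrite rb /= => ->.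
exists (sigma \o x).
  move=> P [phi phiP]; rewrite -!phiP /holds -(automorphism_sat _ _ aut).
  have -> // : sigma \o join x (fun c : B => val c) = join (sigma \o x) (fun c : B => val c).
  by apply/funext => -[//|c] /=; apply: sB'; exact: set_mem (valP c).
apply/funext => k /=; have Ak : A (x (h k)) by right; exists k.
have := sE (in_sub Ak); rewrite /f; have [+ _] := rP (in_sub Ak).
(* The name chosen for this entry may be another index or an element of [B]; the equality is part of
   the type, so it holds in [w] too. *)
case: (r _) => [k'|b] /= rk -> .
  exact: (xhw _ (definable_over_eq B k' k) rk).
exact/esym/(xhw _ (definable_over_eq_param k b))/esym.
Qed.

Lemma divides_pred_extend (C : set M) (X Y : Type) (Z : countType) (h : Z -> Y)
    (psi : (X + Z -> M) -> Prop) (e : Y -> M) : small kappa C ->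
  divides_pred C psi (e \o h) -> divides_pred C (fun v => psi (v \o sum_map id h)) e.
Proof.
move=> sC [k [b [be bk]]].
have /choice[c cP] : forall i, exists c, equiv_over C e c /\ c \o h = b i.
  by move=> i; have [y ? ?] := move_tuple sC (be i); exists y.
exists k, c; split=> [i|s sinj [x xP]]; first by have [] := cP i.
apply: bk sinj _; exists x => i; have := xP i.
by rewrite join_sum_map; have [_ ->] := cP (s i).
Qed.

Lemma definable_over_params (C : set M) (X Y : Type) (y : Y -> M) (P : (X -> M) -> Prop) :
  definable_over (C `|` range y) P ->
  exists2 Q : (X + Y -> M) -> Prop, definable_over C Q & forall x, P x <-> Q (join x y).
Proof.
move=> [phi phiP].
have /choice[r rP] : forall a : (C `|` range y), exists t : Y + C,
    join y (fun c : C => val c) t = val a.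
  move=> a; case: (set_mem (valP a)) => [Ca|[k _ yk]]; last by exists (inl k).
  by exists (inr (in_sub Ca)).
pose s (t : X + (C `|` range y)) : (X + Y) + C := match t with
  | inl k => inl (inl k)
  | inr a => match r a with inl k => inl (inr k) | inr c => inr c end end.
exists (fun v => holds v (rename phi s)); first by exists (rename phi s).
move=> x; rewrite -phiP /holds sat_rename -propeqE; congr sat.
by apply/funext => -[//|a] /=; rewrite -rP; case: (r a).
Qed.

Lemma indep_indep_div (C : set M) (X Y : Type) (x : X -> M) (y : Y -> M) (p : nat)
    (f : 'I_p -> Y) : indep C x (range y) -> indep_div C x (y \o f).
Proof.
move=> xy psi [phi phiP] psixy divpsi; apply: xy.
exists 1, (fun=> p), (fun=> phi), (fun=> y \o f); split=> [_|x' x'P].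
  apply/divides_predP; move: divpsi; congr (divides_pred C _ _).
  by apply/funext => v; apply/propext; rewrite phiP.
exists ord0; apply/phiP.
have dpsi : definable_over C psi by exists phi.
have [phi' phi'P] := definable_over_inst (y := y \o f) (@subsetUl _ C (range y))
  (fun k => or_intror (imageT y (f k))) dpsi.
by apply/phi'P; apply: x'P; apply/phi'P.
Qed.

End Automorphisms.

Import Order.TTheory.

Section Indiscernible.
Variables (L : language) (M : structure L) (C : set M).
Variables (d : Order.disp_t) (I : orderType d) (Y : Type) (a : I -> Y -> M).
Hypothesis infI : infinite_set [set: I].
Hypothesis indC : indiscernible C a.

Lemma indiscernible_equiv (n : nat) (s t : seq I) (P : ('I_n * Y -> M) -> Prop) (i0 : I) :
  sorted <%O s -> sorted <%O t -> size s = n -> size t = n -> definable_over C P ->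
  P (fun z => a (nth i0 s z.1) z.2) -> P (fun z => a (nth i0 t z.1) z.2).
Proof.
move=> ss st sn tn dP.
have incr (u : seq I) : sorted <%O u -> size u = n ->
    forall k l : 'I_n, k < l -> (nth i0 u k < nth i0 u l)%O.
  move=> su un k l kl; rewrite (sorted_ltn_nth lt_trans)// inE un;
  exact: ltn_ord.
have /equiv_overP := indC (s := fun k : 'I_n => nth i0 s k)
  (t := fun k : 'I_n => nth i0 t k) (incr s ss sn) (incr t st tn).
by apply.
Qed.

Lemma long_sorted_seq (n : nat) : exists2 s : seq I, sorted <%O s & size s = n.
Proof.
have [f finj] := (infinite_setT_embeds I).1 infI.
exists (sort <=%O [seq f k | k <- iota 0 n]); last by rewrite size_sort size_map size_iota.
by rewrite sort_lt_sorted map_inj_uniq// iota_uniq.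
Qed.

Lemma indiscernible_same_type i j : equiv_over C (a i) (a j).
Proof.
move=> P dP Pi.
have := @indiscernible_equiv 1 [:: i] [:: j]
  (fun v => P (fun y => v (ord0, y))) i erefl erefl erefl erefl.
apply=> //.
exact: (class_rename (definable_over_class C) (fun y => (ord0, y)) dP).
Qed.

(* The parameters [c] come from indices other than [i]. In a longer sequence,
   the indices below and above [i] can be spread out so as to leave room for
   any number of indices in the position of [i]. *)
Lemma indiscernible_consistent (q : nat) (i : I) (f : 'I_q -> {j : I | j != i} * Y)
    (Q : ('I_q + Y -> M) -> Prop) (N : nat) (t : 'I_N -> I) :
  definable_over C Q -> Q (join (others a i \o f) (a i)) -> injective t ->
  exists x : 'I_q -> M, forall k, Q (join x (a (t k))).
Proof.
move=> dQ Qi tinj; have dcl := definable_over_class C.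
pose D := sort <=%O (undup (i :: [seq val (f k).1 | k <- enum 'I_q])).
have sD : sorted <%O D by rewrite sort_lt_sorted undup_uniq.
have iD : i \in D by rewrite mem_sort mem_undup mem_head.
have fD k : val (f k).1 \in D.
  rewrite mem_sort mem_undup inE; apply/orP; right.
  by apply: (map_f (fun k => val (f k).1)); rewrite mem_enum.
have [W sW szW] := long_sorted_seq (size D + N).
pose u := index i D; have uD : u < size D by rewrite index_mem.
pose idx k := index (val (f k).1) D.
have idxD k : idx k < size D by rewrite index_mem.
have idxu k : idx k != u.
  apply/eqP => /(congr1 (nth i D)); rewrite !nth_index// => e.
  by have := valP (f k).1; rewrite /= e eqxx.
(* Ranks below that of [i] stay, ranks above it shift by [N], and [i] itself may take any of the [N]
   positions from [u] on. *)
pose pos m r := if r < u then r else if r == u then u + m else r + N.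
have pos_lt m r : m < N -> r < size D -> pos m r < size D + N.
  move=> mN rD; rewrite /pos; case: (ltngtP r u) => h.
  - exact: ltn_addr.
  - by rewrite ltn_add2r.
  - by rewrite (leq_trans (_ : _ < u + N)) ?ltn_add2l// leq_add2r ltnW.
have pos_incr m r r' : m < N -> r < r' -> pos m r < pos m r'.
  move=> mN rr'; rewrite /pos.
  case: (ltngtP r u) => h; case: (ltngtP r' u) => h' //.
  - exact: ltn_addr.
  - by rewrite (leq_trans h)// leq_addr.
  - by have := ltn_trans rr' h'; rewrite ltnNge (ltnW h).
  - by rewrite ltn_add2r.
  - by move: rr'; rewrite h' ltnNge (ltnW h).
  - by move: rr'; rewrite h ltnNge (ltnW h').
  - by rewrite (leq_trans (_ : _ < u + N)) ?ltn_add2l// leq_add2r ltnW.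
  - by move: rr'; rewrite h h' ltnn.
have posu m : pos m u = u + m by rewrite /pos ltnn eqxx.
have nthW r r' : r < r' -> r' < size D + N -> (nth i W r < nth i W r')%O.
  move=> rr' r'W; rewrite (sorted_ltn_nth lt_trans)// inE szW//.
  exact: ltn_trans r'W.
pose x0 (k : 'I_q) : M := a (nth i W (pos 0 (idx k))) (f k).2.
have Qw m : m < N -> Q (join x0 (a (nth i W (u + m)))).
  move=> mN; pose Wm := [seq nth i W (pos m r) | r <- iota 0 (size D)].
  have szWm : size Wm = size D by rewrite size_map size_iota.
  have nthWm r : r < size D -> nth i Wm r = nth i W (pos m r).
    by move=> rD; rewrite (nth_map 0) ?size_iota// nth_iota.
  have sWm : sorted <%O Wm.
    apply/(sortedP i) => r; rewrite szWm => rD; rewrite !nthWm ?(ltnW rD)//.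
    by apply: nthW; [exact: pos_incr|exact: pos_lt].
  pose h (v : 'I_q + Y) : 'I_(size D) * Y := match v with
    | inl k => (Ordinal (idxD k), (f k).2) | inr y => (Ordinal uD, y) end.
  have := @indiscernible_equiv (size D) D Wm (fun v => Q (v \o h)) i sD sWm erefl szWm.
  move=> /(_ (class_rename dcl h dQ)) H.
  have: Q (join x0 (a (nth i W (pos m u)))); last by rewrite posu.
  have -> : join x0 (a (nth i W (pos m u))) =
      (fun z : 'I_(size D) * Y => a (nth i Wm z.1) z.2) \o h.
    apply/funext => -[k|y] /=; rewrite nthWm// /x0.
    by rewrite /pos; case: (ltngtP (idx k) u) (idxu k).
  apply: H; move: Qi; congr Q; apply/funext => -[k|y] /=.
    by rewrite /others nth_index.
  by rewrite nth_index.
(* That some [x] works for [N] terms at once is a formula about these terms, so it passes from the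
   middle of [W] to the indices [t], once sorted. *)
pose R (v : 'I_N * Y -> M) := exists x : 'I_q -> M, forall k, Q (join x (fun y => v (k, y))).
have dR : definable_over C R.
  pose h k (v : 'I_q + Y) : 'I_N * Y + 'I_q :=
    match v with inl k => inr k | inr y => inl (k, y) end.
  have := class_ex dcl (class_bigand dcl (fun k => class_rename dcl (h k) dQ)).
  have hE v x k : join v x \o h k = join x (fun y => v (k, y)) by apply/funext => -[].
  by apply: class_iff => v; split=> -[x xP]; exists x => k; have := xP k; rewrite hE.
pose mid := [seq nth i W (u + m) | m <- iota 0 N].
have nth_mid m : m < N -> nth i mid m = nth i W (u + m).
  by move=> mN; rewrite (nth_map 0) ?size_iota// nth_iota.
have szmid : size mid = N by rewrite size_map size_iota.
have smid : sorted <%O mid.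
  apply/(sortedP i) => r; rewrite szmid => rN; rewrite !nth_mid ?(ltnW rN)//.
  by apply: nthW; rewrite ?ltn_add2l// -addnS leq_add// ltnW.
pose S := sort <=%O [seq t k | k <- enum 'I_N].
have sS : sorted <%O S by rewrite sort_lt_sorted map_inj_uniq// enum_uniq.
have szS : size S = N by rewrite size_sort size_map size_enum_ord.
have [|x xP] := indiscernible_equiv smid sS szmid szS dR (i0 := i).
  exists x0 => k /=; rewrite nth_mid//; exact: Qw.
exists x => k; have tS : t k \in S by rewrite mem_sort map_f// mem_enum.
have kS : index (t k) S < N by rewrite -szS index_mem.
by have := xP (Ordinal kS); rewrite /= nth_index.
Qed.

End Indiscernible.

(** * Witnesses *)

Section Witnesses.
Variables (L : language) (M : structure L) (kappa : Type) (C : set M).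
Hypothesis kappa_nat : small kappa [set: nat].
Hypothesis satM : saturated M kappa.
Hypothesis homM : strongly_homogeneous M kappa.
Hypothesis smallC : small kappa C.
Hypothesis NIP : forall n m (phi : formula L ('I_n + 'I_m)), ~ has_IP M phi.
Variables (d : Order.disp_t) (I : orderType d) (Y : Type) (a : I -> Y -> M).
Hypothesis infI : infinite_set [set: I].
Hypothesis indC : indiscernible C a.

Let dcl := definable_over_class C.

Lemma definable_finite_support (X : finType) (psi : (X + Y -> M) -> Prop) :
  definable_over C psi -> exists p (g : 'I_p -> Y) (psi' : (X + 'I_p -> M) -> Prop),
    definable_over C psi' /\ forall v, psi v <-> psi' (v \o sum_map id g).
Proof.
move=> dpsi; have [S fS dS] := definable_over_support dpsi.
have [p [g [_ gP]]] := finite_set_enum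
  (bigcup_finite fS (fun o _ => match o return
     finite_set (if o is inr k then [set k] else set0 : set Y) with
     | inr k => finite_set1 k | inl _ => finite_set0 Y end)).
have [|psi' dpsi' psiE] := class_factor (f := sum_map id g) dcl dS _ dpsi.
  move=> [x|y] Sk; first by exists (inl x).
  by have [|j <-] := (gP y).1; [exists (inr y)|exists (inr j)].
by exists p, g, psi'; split=> // v; rewrite psiE.
Qed.

Lemma indep_witness : (forall i, indep C (others a i) (range (a i))) -> witness C a.
Proof.
move=> inda; split=> // [i j|n phi e ea divphi J Jnat [x xP]].
  by apply/equiv_overP; exact: indiscernible_same_type.
have dphi : definable_over C (fun v : 'I_n + Y -> M => holds v phi) by exists phi.
have [p [g [psi [dpsi psiE]]]] := definable_finite_support dphi.
have [N Nbound] := not_shattered_bound kappa_nat satM smallC NIP dpsi.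
have [s sinj] : embeds nat J.
  apply: embeds_trans (embeds_Tset _) _; apply/card_leP_embeds.
  by move: Jnat; rewrite card_eq_le => /andP[].
pose j (k : 'I_N) : I := val (s k).
have jinj : injective j by move=> k k' /val_inj/sinj/val_inj.
apply: (Nbound 'I_N (fun k => a (j k) \o g)); first by rewrite card_ord.
apply: (independent_terms_shattered dpsi).
- move=> k; apply: (divides_pred_rename (f := id)); last by [].
  have : divides_pred C (fun v => holds v phi) (a (j k)).
    apply: (divides_pred_equiv _ ((divides_predP _ _).1 divphi)).
    by apply/equiv_overP; exact: ea.
  by congr (divides_pred C _ _); apply/funext => v; apply/propext; exact: psiE.
- move=> k; have H := indep_indep_div (f := g) (inda (j k)).
  have jk (l : {l | l != k}) : j (val l) != j k.
    by apply/eqP => /jinj lk; have := valP l; rewrite lk eqxx.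
  pose h (z : {l | l != k} * 'I_p) : {i | i != j k} * Y :=
    (exist _ (j (val z.1)) (jk z.1), g z.2).
  exact: (indep_div_renameL (f := h) H).
- exists x => k; have := xP (j k) (set_mem (valP (s k))).
  by rewrite psiE join_sum_map.
Qed.

Hypothesis baseC : extension_base C.
Hypothesis smallY : small kappa [set: Y].

Lemma small_range_type (U : Type) (y : Y -> U) : small kappa (range y).
Proof. by move=> h; apply: smallY; exact: card_le_trans h (card_image_le _ _). Qed.

(* Compactness gives finitely many parameters, and homogeneity moves the finite
   part of the infinite tuple [others a i] that matters. *)
Lemma forks_formula (i : I) : forks C (tp (C `|` range (a i)) (others a i)) ->
  exists (q : nat) (f : 'I_q -> {j : I | j != i} * Y) (n : nat) (m : 'I_n -> nat)
    (psi : forall l, ('I_q + 'I_(m l) -> M) -> Prop) (b : forall l, 'I_(m l) -> M)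
    (Q : ('I_q + Y -> M) -> Prop),
  [/\ forall l, definable_over C (psi l) /\ divides_pred C (psi l) (b l),
      definable_over C Q, Q (join (others a i \o f) (a i)) &
      forall w, Q (join w (a i)) -> exists l, psi l (join w (b l))].
Proof.
move=> [n [m [psi0 [b [divb cover]]]]].
set X := ({j : I | j != i} * Y)%type in psi0 divb cover *.
have d0 l : definable_over C (fun v : X + 'I_(m l) -> M => holds v (psi0 l)).
  by exists (psi0 l).
have [T fT dT] : exists2 T : set X, finite_set T & forall l,
    depends [set k | if k is inl k then T k else True]
      (fun v : X + 'I_(m l) -> M => holds v (psi0 l)).
  have /choice[T TP] : forall l, exists T : set X, finite_set T /\
      depends [set k | if k is inl k then T k else True]
        (fun v : X + 'I_(m l) -> M => holds v (psi0 l)).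
    move=> l; have [S fS dS] := definable_over_support (d0 l).
    exists (\bigcup_(o in S) (if o is inl k then [set k] else set0)); split.
      by apply: bigcup_finite => // -[k|k] _; [exact: finite_set1|].
    by apply: dependsS dS => -[k|k] Sk //=; exists (inl k).
  exists (\bigcup_l T l); first by apply: bigcup_finite => // l _; have [] := TP l.
  move=> l; have [_] := TP l; apply: dependsS => -[k|k] //= Tk.
  by exists l.
have [q [f [finj fP]]] := finite_set_enum fT.
have /(_ _)/cid2-/all_sig2[psi dpsi psiE] l :
    exists2 psi : ('I_q + 'I_(m l) -> M) -> Prop, definable_over C psi &
    forall v, holds v (psi0 l) = psi (v \o sum_map f id).
  apply: (class_factor dcl (dT l) _ (d0 l)) => -[k|k] /=; last by exists (inr k).
  by move=> /fP[k' <-]; exists (inl k').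
pose B := C `|` range (a i).
have sB : small kappa B by apply: smallU => //; exact: small_range_type.
have [P [dP Px0 Pcover]] : exists P : ('I_q -> M) -> Prop,
    [/\ definable_over B P, P (others a i \o f) &
    forall w, P w -> exists l, psi l (join w (b l))].
  apply: contrapT => /forallNP nP.
  pose bb (t : {l : 'I_n & 'I_(m l)}) := b (tag t) (tagged t).
  have [|||||w wP] := @saturation _ _ _ kappa_nat satM 'I_q (B `|` range bb)
    (('I_q -> M) -> Prop) (fun P => definable_over B P /\ P (others a i \o f))
    (fun P w => P w /\ ~ exists l, psi l (join w (b l))).
  - apply: smallU => //; exact: small_range.
  - by exists (fun=> True); split=> //; exact: (class_true (definable_over_class B)).
  - move=> P P' [dP Px] [dP' P'x]; exists (fun w => P w /\ P' w).
      by split=> //; exact: (class_and (definable_over_class B)).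
    by move=> w [[]].
  - move=> P [dP _]; have dA := definable_over_class (B `|` range bb).
    apply: (class_and dA); first by apply: definable_overS dP; left.
    apply: (class_not dA); apply: (class_bigor dA) => l.
    apply: definable_over_inst (dpsi l) => [c Cc|k]; first by left; left.
    by right; exists (Tagged (fun l => 'I_(m l)) k).
  - move=> P [dP Px]; apply: contrapT => nw; apply: (nP P); split=> // w Pw.
    by apply: contrapT => nl; apply: nw; exists w.
  have xw : equiv_over B (others a i \o f) w by move=> P dP Px; have [] := wP P (conj dP Px).
  have [y xy yf] := move_tuple kappa_nat homM sB xw.
  have [|l] := cover y.
    by move=> phi; apply: (xy (fun x => holds x phi)); exists phi.
  rewrite psiE join_sum_map yf => pl.
  have [_ []] := wP (fun=> True) (conj (class_true (definable_over_class B) _) Logic.I).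
  by exists l.
have [Q dQ QP] := definable_over_params dP.
exists q, f, n, m, psi, b, Q; split=> //; last 2 first.
- by apply/QP.
- by move=> w /QP/Pcover.
move=> l; split; first exact: dpsi.
apply: (divides_pred_rename (f := f) (g := id)) => //.
have /divides_predP := divb l; congr (divides_pred C _ _).
by apply/funext => v; rewrite psiE.
Qed.

Lemma witness_indep : witness C a -> forall i, indep C (others a i) (range (a i)).
Proof.
move=> [_ _ wit] i /forks_formula[q [f [n [m [psi [b [Q [psiP dQ Qi cover]]]]]]]].
have [p [g [Q' [dQ' QE]]]] := definable_finite_support dQ.
(* [divides_disjunction] expects all instances over one finite tuple, so the relevant part of [a i]
   is joined with the parameters of all the dividing formulas. *)
pose e : 'I_p + {l : 'I_n & 'I_(m l)} -> M :=
  join (a i \o g) (fun t => b (tag t) (tagged t)).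
pose psi2 l (v : 'I_q + ('I_p + {l : 'I_n & 'I_(m l)})%type -> M) :=
  psi l (v \o sum_map id (fun k => inr (Tagged (fun l => 'I_(m l)) k))).
have divQ' : divides_pred C (fun v : 'I_q + ('I_p + {l : 'I_n & 'I_(m l)})%type -> M =>
    Q' (v \o sum_map id inl)) e.
  apply: (divides_disjunction kappa_nat satM smallC NIP baseC (psi := psi2)).
  - by move=> l; apply: (class_rename dcl); have [] := psiP l.
  - move=> l; have [_ divl] := psiP l.
    exact: (divides_pred_extend kappa_nat homM smallC (e := e)
      (h := fun k => inr (Tagged (fun l => 'I_(m l)) k)) divl).
  - exact: (class_rename dcl).
  move=> x; rewrite join_sum_map => Q'x.
  have [|l pl] := cover x; first by rewrite QE join_sum_map.
  by exists l; rewrite /psi2 join_sum_map.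
(* The formula does not mention the added parameters: they are dropped from the dividing sequence,
   which is then extended to all of [a i]. *)
have divQ : divides_pred C Q (a i).
  have := divides_pred_rename divQ' (fun x y e => e).
  move=> /(divides_pred_extend kappa_nat homM smallC (h := g) (e := a i)).
  by congr (divides_pred C _ _); apply/funext => v; apply/propext; rewrite QE.
have [phi phiP] := dQ.
have [t tinj] := (infinite_setT_embeds I).1 infI.
apply: (wit q phi (a i) _ _ (range t)).
- by move=> j; apply/equiv_overP; exact: indiscernible_same_type.
- apply/divides_predP; move: divQ; congr (divides_pred C _ _).
  by apply/funext => v; apply/propext; rewrite phiP.
- by apply: inj_card_eq => k k' _ _; exact: tinj.
(* Indiscernibility gives consistency for finitely many terms at a time; a witness is about
   infinitely many, so compactness is applied along [t]. *)
pose A := C `|` range (fun z : nat * 'I_p => a (t z.1) (g z.2)).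
have [|||||x xP] := @saturation _ _ _ kappa_nat satM 'I_q A _ (fun _ => True)
  (fun N x => forall k : 'I_N, Q' (join x (a (t k) \o g))).
- apply: smallU => //; exact: small_range.
- by exists 0.
- move=> N N' _ _; exists (maxn N N') => // x xP; split=> k.
    exact: xP (widen_ord (leq_maxl _ _) k).
  exact: xP (widen_ord (leq_maxr _ _) k).
- move=> N _; apply: (class_bigand (definable_over_class A)) => k.
  by apply: definable_over_inst dQ' => [c|l]; [left|right; exists (nat_of_ord k, l)].
- move=> N _; have tNinj : injective (fun k : 'I_N => t k) by move=> k k' /tinj/val_inj.
  have [x xP] := indiscernible_consistent infI indC dQ Qi tNinj.
  by exists x => k; rewrite -join_sum_map -QE.
exists x => _ [k _ <-]; apply/phiP; rewrite QE join_sum_map.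
exact: xP k.+1 Logic.I ord_max.
Qed.

End Witnesses.

Theorem theorem4p3 (L : language) (T : set (sentence L)) (kappa : Type)
    (M : structure L) (C : set M)
    (d : Order.disp_t) (I : orderType d) (Y : Type) (a : I -> Y -> M) :
  complete_theory T -> dependent T -> monster T kappa M ->
  small kappa C -> small kappa [set: I] -> small kappa [set: Y] ->
  extension_base C ->
  infinite_set [set: I] -> indiscernible C a ->
  (witness C a <-> forall i : I, indep C (others a i) (range (a i))).
Proof.
move=> _ depT [modM [kappa_nat _] satM homM] smallC _ smallY baseC infI indC.
have NIP := depT M modM; split.
  exact: (witness_indep kappa_nat satM homM smallC NIP infI indC baseC smallY).
exact: (indep_witness kappa_nat satM smallC NIP infI indC).
Qed.
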